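(* For every integer $n \geq 5$, the adjoint trace field $k_n$ of $\Gamma_n$ is $\mathbb{Q}\left(\cos\frac{2\pi}{n}\right)$. In particular, if $p, q \geq 5$ are distinct primes, then the Löbell polyhedra $L_p$ and $L_q$ are incommensurable.
   Context: For $n \geq 5$, consider the combinatorial $3$-polyhedron with $2n+2$ faces whose ''top'' and ''bottom'' faces are $n$-gons and whose lateral surface consists of $2n$ pentagons: $n$ upper pentagons $U_i$ and $n$ lower pentagons $V_i$ ($i \in \mathbb{Z}/n$), where $U_i$ is adjacent to the top face, $U_{i\pm 1}$, $V_i$ and $V_{i+1}$, and $V_i$ is adjacent to the bottom face, $V_{i\pm1}$, $U_{i-1}$ and $U_i$. By Andreev's theorem it is realized, uniquely up to isometry, as a compact polyhedron $L_n \subset \mathbb{H}^3$ all of whose dihedral angles are $\pi/2$; this is the Löbell polyhedron $L_n$. Let $\Gamma_n < \mathrm{Isom}(\mathbb{H}^3)$ be the group generated by the reflections in the faces of $L_n$; it is a cocompact lattice. The adjoint trace field of a lattice $\Gamma < \mathrm{Isom}(\mathbb{H}^3)$ is $\mathbb{Q}(\{\mathrm{tr}\,\mathrm{Ad}(\gamma) : \gamma \in \Gamma\})$, where $\mathrm{Ad}$ is the adjoint representation of $\mathrm{Isom}(\mathbb{H}^3) = \mathrm{O}'_{3,1}$ on its (real) Lie algebra. Two polyhedra $L_p, L_q$ are commensurable if $\Gamma_p$ and some conjugate of $\Gamma_q$ in $\mathrm{Isom}(\mathbb{H}^3)$ have intersection of finite index in both, and incommensurable otherwise. *)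

(* Defs.v *)
From HB Require Import structures.
From mathcomp Require Import all_boot all_order all_algebra.
From mathcomp Require Import all_classical all_reals all_analysis.
Set Implicit Arguments.
Unset Strict Implicit.
Unset Printing Implicit Defensive.
Import Order.TTheory GRing.Theory Num.Theory.
Import numFieldNormedType.Exports.
Local Open Scope classical_set_scope.
Local Open Scope ring_scope.

(* Hyperboloid model. Points are column vectors of R^{3,1}; the last
   coordinate is the timelike one. *)
Section Hyperbolic.
Variable R : realType.

Definition J31 : 'M[R]_4 :=
  diag_mx (\row_(i < 4) (if i == ord_max then -1 else 1)).

Definition lform (x y : 'cV[R]_4) : R := (x^T *m J31 *m y) 0 0.

Definition H3 : set 'cV[R]_4 :=
  [set x | lform x x = -1 /\ 0 < x ord_max 0].

(* Isom(H^3) = O'_{3,1}, the Lorentz transformations preserving the sheet. *)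
Definition IsomH3 : set 'M[R]_4 :=
  [set g | g^T *m J31 *m g = J31 /\ forall x, H3 x -> H3 (g *m x)].

(* x |-> x - 2 <e, x> e, for e with <e, e> = 1. *)
Definition reflection (e : 'cV[R]_4) : 'M[R]_4 :=
  1%:M - 2%:R *: (e *m (e^T *m J31)).

Definition is_subgroup (G : set 'M[R]_4) : Prop :=
  [/\ G `<=` IsomH3, G 1%:M,
      forall g h, G g -> G h -> G (g *m h)
    & forall g, G g -> G (invmx g)].

Definition conj_group (g : 'M[R]_4) (H : set 'M[R]_4) : set 'M[R]_4 :=
  [set g *m h *m invmx g | h in H].

Definition finite_index (H G : set 'M[R]_4) : Prop :=
  H `<=` G /\ finite_set [set [set g *m h | h in H] | g in G].

Definition commensurable (G H : set 'M[R]_4) : Prop :=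
  exists2 g, IsomH3 g &
    finite_index (G `&` conj_group g H) G /\
    finite_index (G `&` conj_group g H) (conj_group g H).

(* The Lie algebra of O_{3,1}. *)
Definition so31_defect (X : 'M[R]_4) : 'M[R]_4 := X^T *m J31 + J31 *m X.

Fact so31_defect_is_linear : linear so31_defect.
Proof.
by move=> a X Y; rewrite /so31_defect linearP mulmxDl mulmxDr /= -scalemxAl
  -scalemxAr scalerDr addrACA.
Qed.

HB.instance Definition _ :=
  GRing.isLinear.Build R 'M[R]_4 'M[R]_4 _ so31_defect so31_defect_is_linear.

Definition so31 : {vspace 'M[R]_4} := lker (linfun so31_defect).

Lemma mem_so31 (X : 'M[R]_4) :
  (X \in so31) = (X^T *m J31 + J31 *m X == 0).
Proof. by rewrite memv_ker lfunE. Qed.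

Definition Ad (g X : 'M[R]_4) : 'M[R]_4 := g *m X *m invmx g.

(* Ad g maps so31 to itself when g is in IsomH3; its trace on so31 is computed
   in the basis vbasis so31. *)
Definition trAd (g : 'M[R]_4) : R :=
  \sum_(i < \dim so31) coord (vbasis so31) i (Ad g (vbasis so31)`_i).

(* Q(S): the least subfield of R containing S; in a field, divring_closed
   says that K is a subfield. *)
Definition Qadjoin (S : set R) : set R :=
  smallest [set K : set R | divring_closed (mem K)] S.

Definition adjoint_trace_field (G : set 'M[R]_4) : set R :=
  Qadjoin [set trAd g | g in G].

(* A polyhedron of H^3 whose faces are labelled by I is given by the outward
   normals e i of its faces. *)
Section Polyhedron.
Variables (I : Type) (e : I -> 'cV[R]_4).

Definition polyhedron : set 'cV[R]_4 :=
  [set x | H3 x /\ forall i, lform (e i) x <= 0].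

Definition face (i : I) : set 'cV[R]_4 :=
  polyhedron `&` [set x | lform (e i) x = 0].

(* The normals are unit vectors, and every face has a point lying on no other
   face, so that polyhedron has nonempty interior, each face i is
   two-dimensional and distinct labels give distinct faces. *)
Definition is_polyhedron : Prop :=
  (forall i, lform (e i) (e i) = 1) /\
  (forall i, exists2 x, face i x & forall j, face j x -> j = i).

(* Two faces of a convex polyhedron meet in the empty set, a vertex or an
   edge; they are adjacent when they share an edge, i.e. more than one point. *)
Definition adjacent (i j : I) : Prop :=
  i <> j /\ exists x y, [/\ x <> y, (face i `&` face j) x
                                  & (face i `&` face j) y].

(* The interior dihedral angle; the sign is due to the normals being outward. *)
Definition dihedral_angle (i j : I) : R := acos (- lform (e i) (e j)).

Definition right_angled : Prop :=
  forall i j, adjacent i j -> dihedral_angle i j = pi / 2%:R.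

Definition reflection_group : set 'M[R]_4 :=
  smallest is_subgroup [set reflection (e i) | i in [set: I]].

End Polyhedron.
End Hyperbolic.

(* 'Z_n is Z/n only for n > 1; here n >= 5. *)
Inductive lobell_face (n : nat) : Type :=
  | Top | Bottom | Upper of 'Z_n | Lower of 'Z_n.

Definition lobell_adj (n : nat) (F G : lobell_face n) : Prop :=
  match F, G with
  | Top, Upper _ | Upper _, Top => True
  | Bottom, Lower _ | Lower _, Bottom => True
  | Upper i, Upper j | Lower i, Lower j => j = i + 1 \/ j = i - 1
  | Upper i, Lower j | Lower j, Upper i => j = i \/ j = i + 1
  | _, _ => False
  end.

(* A face has as many sides as it has adjacent faces, so the adjacencies make
   the top and bottom faces n-gons and all the other faces pentagons. *)
Definition is_lobell_polyhedron (R : realType) (n : nat)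
    (e : lobell_face n -> 'cV[R]_4) : Prop :=
  [/\ is_polyhedron e, compact (polyhedron e),
      forall F G, adjacent e F G <-> lobell_adj F G
    & right_angled e].

(* Main.v *)
Require Import Defs.
From HB Require Import structures.
From mathcomp Require Import all_boot all_order all_algebra all_field.
From mathcomp Require Import all_classical all_reals all_analysis.
From mathcomp Require Import ring lra zify.
From mathcomp Require complex.
Import Order.TTheory GRing.Theory Num.Theory.
Import numFieldNormedType.Exports.
Set Implicit Arguments.
Unset Strict Implicit.
Unset Printing Implicit Defensive.
Local Open Scope classical_set_scope.
Local Open Scope ring_scope.

(** Let t, b, u(i), v(i) be the unit normals of the top, bottom, upper and lower
    faces. The proof rests on three facts: normals of adjacent faces are orthogonal,
    they have unit length, and distinct faces lie in distinct planes.

    Rigidity. The faces t, u(i-1), u(i), v(i) are such that the part p(i) of v(i)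
    orthogonal to t is also orthogonal to u(i-1) and u(i), so that t, u(i-1),
    u(i), p(i) is an orthogonal frame and p(i) is timelike. Expanding b and
    p(i+1), p(i-1) in this frame gives, for A(i) = - p(i).p(i) > 0 and s = t.b,
        1 / s^2 = 1 / A(i) - 1 / (A(i) + A(i+1) + 1) - 1 / (A(i) + A(i-1) + 1).
    Comparing the equation at a maximal and at a minimal A(i) shows that all A(i)
    are equal to one number A and that s^2 = A (2 A + 1) [lobell_rigidity].
    After changing signs of normals, which changes no reflection, the frames at
    i and i+1 are related by formulas with coefficients in Q(A) and s only
    [normalized_next, normalized_prev]. They imply that the differences
    d(i) = p(i+1) - p(i) satisfy d(i+1) - 2 c d(i) + d(i-1) = 0 with
    c = 1 / (2 A), and as the p(i) are n distinct vectors, c = cos (2 pi k / n)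
    for some k prime to n [normalized_angle].

    The trace field. Suitable multiples of all the normals have coordinates in
    Q(A) = Q(c) in one frame, and the squares of the factors are in Q(c); hence traces are in Q(c) [rational_trace], and so are the adjoint
    traces ((tr g)^2 - tr (g^2)) / 2 [trAdE]. Conversely, the product of the
    reflections in t and v(0) has adjoint trace 8 (A + 1) - 2. As k is prime to
    n, Q(c) = Q(cos (2 pi / n)).

    Incommensurability. Let g be the product of the reflections in u(0) and
    u(2). If the groups for p and q are commensurable, some power g^m, m > 0, of
    the element g of the first group is conjugate into the second, so its trace
    is in Q(cos (2 pi / q)) and has degree at most (q - 1) / 2. This trace is
    F(c) for a rational polynomial F built from the Chebyshev polynomial T_m.
    The conjugates of c are the numbers cos (2 pi j / p), and F takes the value
    F(c) at c only among them, because u(0).u(2) = - (1 + 2 c) has absolute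
    value greater than 1 and c is the only point of [-1, 1] where (1 + 2 x)^2
    takes its value at c. So F(c) has degree (p - 1) / 2, and
    (p - 1) / 2 <= (q - 1) / 2 [lobell_degree_le]. By symmetry p = q. *)

(** * The Lorentz form and its isometries *)

Section LorentzForm.
Variable R : realType.
Implicit Types (x y z e f a b c p : 'cV[R]_4) (g h : 'M[R]_4).
Local Notation "<< x , y >>" := (lform x y).

Lemma lformDl x y z : <<x + y, z>> = <<x, z>> + <<y, z>>.
Proof. by rewrite /lform linearD /= !mulmxDl mxE. Qed.

Lemma lformZl k x z : <<k *: x, z>> = k * <<x, z>>.
Proof. by rewrite /lform linearZ /= -!scalemxAl mxE. Qed.

Lemma trmx_J31 : (J31 R)^T = J31 R.
Proof. exact: tr_diag_mx. Qed.

Lemma lformC x y : <<x, y>> = <<y, x>>.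
Proof.
rewrite /lform -[in LHS](trmxK (x^T *m J31 R *m y)) mxE.
by rewrite !trmx_mul trmxK trmx_J31 mulmxA.
Qed.

Lemma lformDr x y z : <<z, x + y>> = <<z, x>> + <<z, y>>.
Proof. by rewrite lformC lformDl !(lformC z). Qed.

Lemma lformZr k x z : <<z, k *: x>> = k * <<z, x>>.
Proof. by rewrite lformC lformZl (lformC z). Qed.

Lemma lformNl x z : <<- x, z>> = - <<x, z>>.
Proof. by rewrite -scaleN1r lformZl mulN1r. Qed.

Lemma lformNr x z : <<z, - x>> = - <<z, x>>.
Proof. by rewrite -scaleN1r lformZr mulN1r. Qed.

Lemma lform0l z : <<0, z>> = 0.
Proof. by rewrite -(scale0r 0) lformZl mul0r. Qed.

Lemma lform0r z : <<z, 0>> = 0.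
Proof. by rewrite lformC lform0l. Qed.

Definition lformE := (lformDl, lformDr, lformZl, lformZr, lformNl, lformNr).

Lemma lform_mulmx g x y : g^T *m J31 R *m g = J31 R ->
  <<g *m x, g *m y>> = <<x, y>>.
Proof. by move=> gJ; rewrite /lform trmx_mul -{2}gJ !mulmxA. Qed.

Lemma lform_coords x y :
  <<x, y>> = x 0 0 * y 0 0 + x 1 0 * y 1 0 + x 2%:R 0 * y 2%:R 0
             - x ord_max 0 * y ord_max 0.
Proof.
rewrite /lform /J31 mxE !big_ord_recr big_ord0 /= add0r !mul_mx_diag !mxE /=.
rewrite !mulr1 mulrN1 mulNr.
do !congr (_ + _); first [congr (x _ _ * y _ _) | congr (- (x _ _ * y _ _))];
  exact/val_inj.
Qed.

Lemma det_J31 : \det (J31 R) = -1.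
Proof.
rewrite /J31 det_diag !big_ord_recr big_ord0 /= !mxE /=.
by rewrite !mul1r.
Qed.

(** The matrix E with columns a, b, c, p has Gram matrix diag(1, 1, 1, p.p), so
    p.p is minus the square of det E. A linear relation between the columns is
    killed by the Gram matrix, hence involves p only, and p is not 0. *)
Lemma lorentz_frame a b c p :
    <<a, a>> = 1 -> <<b, b>> = 1 -> <<c, c>> = 1 ->
    <<a, b>> = 0 -> <<a, c>> = 0 -> <<b, c>> = 0 ->
    <<a, p>> = 0 -> <<b, p>> = 0 -> <<c, p>> = 0 -> p != 0 ->
  <<p, p>> < 0 /\
  forall x, <<a, x>> = 0 -> <<b, x>> = 0 -> <<c, x>> = 0 -> <<p, x>> = 0 ->
    x = 0.
Proof.
move=> aa bb cc ab ac bc ap bp cp p0.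
pose E : 'M[R]_4 := \matrix_(i, j) (tnth [tuple a; b; c; p] j) i 0.
have colE j : col j E = tnth [tuple a; b; c; p] j.
  by apply/matrixP => i k; rewrite !mxE ord1.
have gramE x j : (E^T *m J31 R *m x) j 0 = <<tnth [tuple a; b; c; p] j, x>>.
  by rewrite -colE /lform tr_col -!row_mul [RHS]mxE.
pose d : 'rV[R]_4 := \row_j (if j == ord_max then <<p, p>> else 1).
have gram : E^T *m J31 R *m E = diag_mx d.
  apply/matrixP => i j.
  have -> : (E^T *m J31 R *m E) i j = (E^T *m J31 R *m col j E) i 0.
    by rewrite matrix.colE mulmxA -matrix.colE [RHS]mxE.
  rewrite gramE colE !mxE.
  case: i => [[|[|[|[|//]]]] hi]; case: j => [[|[|[|[|//]]]] hj];
    rewrite !(tnth_nth 0) /= ?mulr1n ?mulr0n //; by rewrite lformC.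
have detE : \det E ^+ 2 = - <<p, p>>.
  have := congr1 determinant gram.
  rewrite !det_mulmx det_tr det_J31 det_diag !big_ord_recr big_ord0 /= !mxE /=.
  by rewrite !mul1r => <-; rewrite mulrN1 mulNr opprK.
have Eunit : \det E != 0.
  apply/negP => E0; move: (E0); rewrite -det_tr => /det0P[v v0 vE].
  have : v *m diag_mx d = 0 by rewrite -gram !mulmxA vE !mul0mx.
  move=> /rowP vd.
  have vi (j : 'I_4) : j != ord_max -> v 0 j = 0.
    move=> jm; have := vd j; rewrite mul_mx_diag !mxE (negbTE jm).
    by rewrite mulr1.
  have vp : v 0 ord_max *: p = 0.
    apply/colP => i; have := congr1 (fun m : 'rV[R]_4 => m 0 i) vE.
    rewrite [LHS]mxE (bigD1 ord_max) //= big1 ?addr0; last first.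
      by move=> j jm; rewrite vi // mul0r.
    by rewrite !mxE (tnth_nth 0).
  move: vp => /eqP; rewrite scaler_eq0 (negbTE p0) orbF => /eqP vm.
  case/eqP: v0; apply/rowP => j; rewrite [RHS]mxE.
  by have [->|/vi] := eqVneq j ord_max.
split.
  by rewrite -oppr_gt0 -detE exprn_even_gt0.
(* E^T J is invertible and sends x to its products with the columns. *)
move=> x ax bx cx px.
have Jx : E^T *m J31 R *m x = 0.
  apply/colP => j; rewrite gramE mxE.
  by case: j => [[|[|[|[|//]]]] hj]; rewrite (tnth_nth 0).
have U : E^T *m J31 R \in unitmx.
  by rewrite unitmxE det_mulmx det_tr det_J31 mulrN1 unitfE oppr_eq0.
by rewrite -(mulKmx U x) Jx mulmx0.
Qed.

Lemma reflectionE e x : reflection e *m x = x - (2 * <<e, x>>) *: e.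
Proof.
rewrite /reflection mulmxBl mul1mx -scalemxAl -[_ *m _ *m x]mulmxA.
congr (_ - _); rewrite -scalerA; congr (_ *: _).
apply/colP => i; rewrite mxE big_ord1 -/(lform _ _) !mxE mulrC.
by rewrite /lform !mxE.
Qed.

Lemma reflectionN e : reflection (- e) = reflection e.
Proof. by rewrite /reflection linearN /= !(mulNmx, mulmxN) opprK. Qed.


Lemma eq_mx_cV (X Y : 'M[R]_4) :
  (forall x : 'cV[R]_4, X *m x = Y *m x) -> X = Y.
Proof.
move=> XY; apply/matrixP => i j; have /colP/(_ i) := XY (delta_mx j 0).
by rewrite -!matrix.colE !mxE.
Qed.

Lemma reflectionK e : <<e, e>> = 1 -> reflection e *m reflection e = 1%:M.
Proof.
move=> ee; apply: eq_mx_cV => x; rewrite -mulmxA !reflectionE mul1mx !lformE ee -addrA.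
rewrite -opprD -scalerDl -[RHS]subr0; congr (_ - _).
by rewrite -[RHS](scale0r e); congr (_ *: _); ring.
Qed.

Lemma reflection_isometry e : <<e, e>> = 1 ->
  (reflection e)^T *m J31 R *m reflection e = J31 R.
Proof.
move=> ee; apply/matrixP => i j.
have lformdelta (M : 'M[R]_4) k l :
    ((delta_mx k 0 : 'cV_4)^T *m M *m (delta_mx l 0 : 'cV_4)) 0 0 = M k l.
  by rewrite trmx_delta -rowE -matrix.colE !mxE.
rewrite -!lformdelta -/(lform (delta_mx i 0) (delta_mx j 0)).
have -> x y : (x^T *m ((reflection e)^T *m J31 R *m reflection e) *m y) 0 0
    = <<reflection e *m x, reflection e *m y>>.
  by rewrite /lform trmx_mul !mulmxA.
by rewrite !reflectionE !lformE ee (lformC (delta_mx i 0) e); ring.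
Qed.

(** Cauchy-Schwarz: the two sheets of the unit hyperboloid are separated by the
    sign of the product with any given point of the upper sheet. *)
Lemma H3_sheet x y : H3 x -> <<y, y>> < 0 -> <<x, y>> < 0 -> 0 < y ord_max 0.
Proof.
rewrite /H3 /= !lform_coords => -[xx x0] yy xy.
move: x0 xx yy xy.
set x3 := x ord_max 0; set y3 := y ord_max 0.
set a0 := x 0 0; set a1 := x 1 0; set a2 := x 2%:R 0.
set b0 := y 0 0; set b1 := y 1 0; set b2 := y 2%:R 0.
move=> x0 xx yy xy; rewrite ltNge; apply/negP => y0.
have cs : (a0 * b0 + a1 * b1 + a2 * b2) ^+ 2
    <= (a0 ^+ 2 + a1 ^+ 2 + a2 ^+ 2) * (b0 ^+ 2 + b1 ^+ 2 + b2 ^+ 2).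
  rewrite -subr_ge0.
  have -> : (a0 ^+ 2 + a1 ^+ 2 + a2 ^+ 2) * (b0 ^+ 2 + b1 ^+ 2 + b2 ^+ 2)
      - (a0 * b0 + a1 * b1 + a2 * b2) ^+ 2
      = (a0 * b1 - a1 * b0) ^+ 2 + (a0 * b2 - a2 * b0) ^+ 2
        + (a1 * b2 - a2 * b1) ^+ 2 by ring.
  by rewrite !addr_ge0 ?sqr_ge0.
have w : a0 * b0 + a1 * b1 + a2 * b2 < x3 * y3 by lra.
have v0 : 0 <= - (x3 * y3) by rewrite -mulrN mulr_ge0 ?oppr_ge0 // ltW.
have : (- (x3 * y3)) ^+ 2 < (a0 * b0 + a1 * b1 + a2 * b2) ^+ 2.
  by rewrite -(sqrrN (_ + a2 * b2)) ltr_pXn2r ?nnegrE //; lra.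
have B : b0 ^+ 2 + b1 ^+ 2 + b2 ^+ 2 < y3 ^+ 2 by rewrite !expr2; lra.
have A0 : a0 ^+ 2 + a1 ^+ 2 + a2 ^+ 2 = x3 ^+ 2 - 1 by rewrite !expr2; lra.
have B0 : 0 <= b0 ^+ 2 + b1 ^+ 2 + b2 ^+ 2 by rewrite !addr_ge0 ?sqr_ge0.
rewrite A0 in cs; rewrite sqrrN exprMn => lt1.
have lt2 := lt_le_trans lt1 cs.
have : (x3 ^+ 2 - 1) * (b0 ^+ 2 + b1 ^+ 2 + b2 ^+ 2) <= x3 ^+ 2 * y3 ^+ 2.
  have x30 : 0 <= x3 ^+ 2 := sqr_ge0 _.
  apply: (@le_trans _ _ (x3 ^+ 2 * (b0 ^+ 2 + b1 ^+ 2 + b2 ^+ 2))).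
    by rewrite mulrBl mul1r gerBl.
  by rewrite ler_wpM2l // ltW.
by rewrite leNgt lt2.
Qed.

(** The sheet is preserved because x.r(x) = - 1 - 2 (e.x)^2 < 0. *)
Lemma reflection_IsomH3 e : <<e, e>> = 1 -> IsomH3 (reflection e).
Proof.
move=> ee; split=> [|x Hx]; first exact: reflection_isometry.
have xx := proj1 Hx.
split; first by rewrite lform_mulmx // reflection_isometry.
apply: (H3_sheet Hx).
  by rewrite lform_mulmx ?reflection_isometry // xx ltrN10.
rewrite reflectionE !lformE xx (lformC x e).
have := sqr_ge0 <<e, x>>; rewrite expr2; lra.
Qed.

Lemma isometry_unit g : g^T *m J31 R *m g = J31 R -> g \in unitmx.
Proof.
move=> gJ; have := congr1 determinant gJ; rewrite !det_mulmx det_tr det_J31.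
rewrite unitmxE unitfE => gg; apply/eqP => g0; move/eqP: gg.
by rewrite g0 mulr0 eq_sym oppr_eq0 oner_eq0.
Qed.

Lemma IsomH3_unit g : IsomH3 g -> g \in unitmx.
Proof. by case=> /isometry_unit. Qed.

Lemma J31K : J31 R *m J31 R = 1%:M.
Proof.
apply/matrixP => i j; rewrite /J31 mul_diag_mx !mxE mulrnAr.
by case: ifP; rewrite ?mulrNN mulr1.
Qed.

Lemma isometry_inv g : g^T *m J31 R *m g = J31 R ->
  invmx g = J31 R *m g^T *m J31 R.
Proof.
move=> gJ; have U := isometry_unit gJ.
rewrite -[RHS](mulmxK U).
have -> : J31 R *m g^T *m J31 R *m g = J31 R *m (g^T *m J31 R *m g).
  by rewrite !mulmxA.
by rewrite gJ J31K mul1mx.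
Qed.

Lemma IsomH3_1 : IsomH3 (1%:M : 'M[R]_4).
Proof. by split=> [|x]; rewrite ?trmx1 ?mul1mx ?mulmx1. Qed.

Lemma IsomH3_mul g h : IsomH3 g -> IsomH3 h -> IsomH3 (g *m h).
Proof.
move=> [gJ gH] [hJ hH]; split=> [|x /hH/gH]; last by rewrite mulmxA.
rewrite trmx_mul.
have -> : h^T *m g^T *m J31 R *m (g *m h) = h^T *m (g^T *m J31 R *m g) *m h.
  by rewrite !mulmxA.
by rewrite gJ.
Qed.

Lemma IsomH3_inv g : IsomH3 g -> IsomH3 (invmx g).
Proof.
move=> gI; have U := IsomH3_unit gI; have [gJ gH] := gI.
have iJ : (invmx g)^T *m J31 R *m invmx g = J31 R.
  by rewrite -{1}gJ -!mulmxA mulmxV // mulmx1 mulmxA -trmx_mul mulmxV // trmx1 mul1mx.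
split=> // x [xx x0].
have yy : <<invmx g *m x, invmx g *m x>> = -1 by rewrite lform_mulmx.
split=> //; rewrite ltNge; apply/negP => y0.
have ne0 : (invmx g *m x) ord_max 0 != 0.
  apply/eqP => y3; move/eqP: yy; rewrite lform_coords y3 mulr0 subr0.
  apply/negP; rewrite gt_eqF // (lt_le_trans (ltrN10 _)) // -!expr2.
  by rewrite !addr_ge0 ?sqr_ge0.
(* Otherwise the opposite point is in the upper sheet and g sends it to - x. *)
have : H3 (- (invmx g *m x)).
  split; first by rewrite lformNl lformNr opprK.
  by rewrite mxE oppr_gt0 lt_def eq_sym ne0.
move=> /gH [_]; rewrite mulmxN mulKVmx // mxE oppr_gt0.
by rewrite ltNge (ltW x0).
Qed.

End LorentzForm.

(** * Traces of Lorentz transformations *)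

Section AdjointTrace.
Variable R : realType.

(** On so(3,1), the second exterior power of the standard representation, the
    trace of g is ((tr g)^2 - tr (g^2)) / 2. It is computed as the trace over
    all matrices of the composite of Ad g with the projection
    X |-> (X - J X^T J) / 2 onto so(3,1), where the elementary matrices give an
    explicit basis. *)
Lemma trAdE (g : 'M[R]_4) : IsomH3 g ->
  trAd g = (\tr g ^+ 2 - \tr (g *m g)) / 2.
Proof.
move=> [gJ _]; have U := isometry_unit gJ.
have gV := isometry_inv gJ.
pose pr (X : 'M[R]_4) := 2^-1 *: (X - J31 R *m X^T *m J31 R).
have prD k X Y : pr (k *: X + Y) = k *: pr X + pr Y.
  have tP : (k *: X + Y)^T = k *: X^T + Y^T by rewrite linearP.
  rewrite /pr tP mulmxDr mulmxDl -scalemxAr -scalemxAl.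
  rewrite scalerA (mulrC k) -scalerA -scalerDr; congr (_ *: _).
  by rewrite opprD addrACA -scalerBr.
have pr0 : pr 0 = 0 by rewrite /pr trmx0 mulmx0 mul0mx subr0 scaler0.
have pr_so X : pr X \in so31 R.
  have tB : (X - J31 R *m X^T *m J31 R)^T = X^T - J31 R *m X *m J31 R.
    by rewrite linearB /= !trmx_mul trmxK trmx_J31 mulmxA.
  rewrite mem_so31 /pr linearZ /= tB -scalemxAl -scalemxAr -scalerDr.
  rewrite mulmxBl mulmxBr -(mulmxA _ (J31 R) (J31 R)) J31K mulmx1.
  by rewrite !mulmxA J31K mul1mx addrA subrK subrr scaler0.
have pr_id X : X \in so31 R -> pr X = X.
  rewrite mem_so31 addr_eq0 => /eqP XJ.
  have -> : pr X = 2^-1 *: (X + X).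
    rewrite /pr -[J31 R *m X^T *m J31 R]mulmxA XJ mulmxN opprK.
    by rewrite mulmxA J31K mul1mx.
  by rewrite -(mulr2n X) -(scaler_nat _ X) scalerA mulVf ?scale1r // pnatr_eq0.
have Ad_so X : X \in so31 R -> Ad g X \in so31 R.
  rewrite !mem_so31 /Ad => /eqP XJ; apply/eqP.

  have Jg : J31 R *m g = (invmx g)^T *m J31 R.
    by rewrite gV !trmx_mul trmxK trmx_J31 -!mulmxA J31K mulmx1.
  have gJ' : g^T *m J31 R = J31 R *m invmx g.
    by rewrite -{2}gJ -!mulmxA mulmxV // mulmx1.
  have -> : J31 R *m (g *m X *m invmx g)
      = (invmx g)^T *m (J31 R *m X) *m invmx g by rewrite !mulmxA Jg.
  have -> : (g *m X *m invmx g)^T *m J31 R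
      = (invmx g)^T *m (X^T *m J31 R) *m invmx g.
    by rewrite !trmx_mul -!mulmxA gJ'.
  by rewrite -mulmxDl -mulmxDr XJ mulmx0 mul0mx.
pose Ad' X := Ad g (pr X).
have AdD k X Y : Ad g (k *: X + Y) = k *: Ad g X + Ad g Y.
  by rewrite /Ad mulmxDr mulmxDl -scalemxAr -scalemxAl.
pose b := vbasis (so31 R).
(* Expand pr (delta_mx i j) on b; recombining the sum over i, j inside the
   coordinate forms gives back the trace in the basis b. *)
have trace_all : trAd g = \sum_i \sum_j Ad' (delta_mx i j) i j.
  transitivity (\sum_(k < \dim (so31 R)) \sum_i \sum_j
      coord b k (pr (delta_mx i j)) * (Ad g b`_k) i j).
    apply: eq_bigr => k _.
    have bk : b`_k \in so31 R by rewrite vbasis_mem // mem_nth // size_tuple.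
    rewrite -[X in coord _ _ X](pr_id _ (Ad_so _ bk)).
    rewrite [X in pr X]matrix_sum_delta.
    have pr_sum (I : Type) (r : seq I) F :
        pr (\sum_(i <- r) F i) = \sum_(i <- r) pr (F i).
      elim: r => [|x r IHr]; first by rewrite !big_nil pr0.
      by rewrite !big_cons -[X in X + _]scale1r prD scale1r IHr.
    rewrite pr_sum linear_sum; apply: eq_bigr => i _.
    rewrite pr_sum linear_sum; apply: eq_bigr => j _.
    by rewrite -[X in pr X]addr0 prD pr0 addr0 linearZ /= mulrC.
  rewrite exchange_big; apply: eq_bigr => i _.
  rewrite exchange_big; apply: eq_bigr => j _.
  rewrite /Ad' {2}(coord_vbasis (pr_so (delta_mx i j))).
  have Ad_sum (I : Type) (r : seq I) (c : I -> R) F :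
      Ad g (\sum_(i <- r) c i *: F i) = \sum_(i <- r) c i *: Ad g (F i).
    elim: r => [|x r IHr]; first by rewrite !big_nil /Ad mulmx0 mul0mx.
    by rewrite !big_cons AdD IHr.
  by rewrite Ad_sum summxE; apply: eq_bigr => k _; rewrite !mxE.
have AdE i j : Ad' (delta_mx i j) i j = 2^-1 * (g i i * g j j - g i j * g j i).
  have Ad1 k l x y : (g *m delta_mx k l *m invmx g) x y = g x k * invmx g l y.
    rewrite -(mul_delta_mx (0 : 'I_1)) mulmxA -mulmxA -matrix.colE -rowE.
    by rewrite mxE big_ord1 !mxE.
  pose sg (i : 'I_4) : R := if i == ord_max then -1 else 1.
  have sg2 k : sg k * sg k = 1 by rewrite /sg; case: ifP; rewrite ?mulrNN mulr1.
  have gVE k l : invmx g k l = sg k * g l k * sg l.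
    by rewrite gV /J31 mul_mx_diag mul_diag_mx !mxE.
  have Jdelta : J31 R *m (delta_mx i j)^T *m J31 R
      = (sg i * sg j) *: delta_mx j i.
    apply/matrixP => k l.
    rewrite trmx_delta /J31 mul_mx_diag mul_diag_mx !mxE -!/(sg _).
    have [->|_] := eqVneq k j; last by rewrite !(mulr0, mul0r).
    have [->|_] := eqVneq l i; last by rewrite !(mulr0, mul0r).
    by rewrite !mulr1 mulrC.
  rewrite /Ad' /pr Jdelta {1}/Ad.
  rewrite -scalemxAr -scalemxAl mulmxBr mulmxBl -scalemxAr -scalemxAl.
  have lin (M N : 'M[R]_4) x y :
      (x *: (M - y *: N)) i j = x * (M i j - y * N i j) by rewrite !mxE.
  rewrite lin !Ad1 !gVE -!mulrA (mulrCA (sg j) (g j j)) sg2 mulr1.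
  congr (_ * (_ - _)).
  transitivity ((sg i * sg i) * (sg j * sg j) * (g i j * g j i)); first by ring.
  by rewrite !sg2 !mul1r.
rewrite trace_all.
under eq_bigr => i _ do under eq_bigr => j _ do rewrite AdE.
under eq_bigr => i _ do rewrite -mulr_sumr sumrB.
rewrite -mulr_sumr sumrB mulrC expr2 /mxtrace; congr ((_ - _) * _).
  by rewrite mulr_suml; apply: eq_bigr => i _; rewrite mulr_sumr.
by apply: eq_bigr => i _; rewrite mxE.
Qed.

End AdjointTrace.

(** * Groups generated by reflections *)

Section ReflectionGroup.
Variables (R : realType) (I : Type) (e : I -> 'cV[R]_4).

Lemma reflection_group_gen i : reflection_group e (reflection (e i)).
Proof. by apply: sub_gen_smallest; exists i. Qed.

Lemma reflection_group_mul g h :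
  reflection_group e g -> reflection_group e h -> reflection_group e (g *m h).
Proof.
move=> gG hG G [subG genG]; case: (subG) => _ _ mulG _.
by apply: mulG; [apply: gG | apply: hG].
Qed.

Lemma reflection_group1 : reflection_group e 1%:M.
Proof. by move=> G [[]]. Qed.

Hypothesis e_unit : forall i, lform (e i) (e i) = 1.

(** IsomH3 is itself a subgroup that contains the reflections, so the group that
    they generate is not an empty intersection. *)
Lemma reflection_group_IsomH3 : reflection_group e `<=` @IsomH3 R.
Proof.
apply: smallest_sub.
  split=> //; [exact: IsomH3_1 | exact: IsomH3_mul | exact: IsomH3_inv].
by move=> _ [i _ <-]; apply: reflection_IsomH3.
Qed.

End ReflectionGroup.

Section FiniteIndex.
Variable R : realType.

(** Two of the cosets g^i H coincide. *)
Lemma finite_index_power (G H : set 'M[R]_4) (g : 'M[R]_4) :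
    finite_index H G -> H 1%:M -> g \in unitmx ->
    (forall m, G (g ^+ m)) ->
  exists2 m, (0 < m)%N & H (g ^+ m).
Proof.
move=> [HG finGH] H1 U Gpow.
have Upow m : g ^+ m \in unitmx by rewrite unitrX.
pose coset m := [set g ^+ m *m h | h in H].
have : finite_set (range coset).
  apply: sub_finite_set finGH => _ [m _ <-].
  by exists (g ^+ m); first exact: Gpow.
move=> /finite_range_cst_subsequence[x [A infA Ax]].
have Agt a : exists2 b, A b & (a < b)%N.
  have [//|noA] := pselect (exists2 b, A b & (a < b)%N).
  case: infA; apply: (@sub_finite_set _ A `I_a.+1) (finite_II _) => b Ab /=.
  by rewrite ltnS leqNgt; apply/negP => ab; apply: noA; exists b.
have [a Aa _] := Agt 0%N; have [b Ab ab] := Agt a.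
have : coset b (g ^+ b) by exists 1%:M; rewrite ?mulmx1.
have /Ax -> := Ab; have /Ax <- := Aa.
move=> [h Hh ghE]; exists (b - a)%N; first by rewrite subn_gt0.
suff -> : g ^+ (b - a) = h by [].
apply: (can_inj (mulKmx (Upow a))).
rewrite ghE -[in RHS](subnKC (ltnW ab)) exprD.
by [].
Qed.
End FiniteIndex.

Section TraceOfPower.
Variable R : realType.
Implicit Types e f : 'cV[R]_4.

(** The range of g - 1 is spanned by e and f, on which g has characteristic
    polynomial X^2 - 2 x X + 1. So N = g^2 - 2 x g + 1 vanishes on the range of
    g - 1, that is N g = N, and the trace of N g^m does not depend on m. *)
Lemma reflection2_recurrence e f (x : R) :
    lform e e = 1 -> lform f f = 1 -> x = 2 * lform e f ^+ 2 - 1 ->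
  let g := reflection e *m reflection f in
  [/\ \tr g = 2 * x + 2, \tr (g *m g) = 4 * x ^+ 2
    & forall m, \tr (g ^+ m.+2) - 2 * x * \tr (g ^+ m.+1) + \tr (g ^+ m)
        = 4 - 4 * x].
Proof.
move=> ee ff; set y := lform e f => xE g.
pose st (a : 'cV[R]_4) := a^T *m J31 R.
have st_mul a b : st a *m b = (lform a b)%:M.
  by apply/matrixP => i j; rewrite !ord1 [RHS]mxE eqxx mulr1n.
have tr_st a b : \tr (a *m st b) = lform b a.
  by rewrite mxtrace_mulC st_mul mxtrace_scalar mulr1n.
have ge : g *m e = (4 * y ^+ 2 - 1) *: e - (2 * y) *: f.
  rewrite /g -mulmxA !reflectionE !lformE (lformC f e) -/y ee.
  by apply/colP => i; rewrite !mxE; ring.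
have gf : g *m f = (2 * y) *: e - f.
  rewrite /g -mulmxA !reflectionE !lformE -/y ff.
  by apply/colP => i; rewrite !mxE; ring.
pose a := (4 * y) *: f - 2 *: e; pose b := - 2 *: f.
have gE : g = 1%:M + e *m st a + f *m st b.
  have stE c k : c *m st (k *: f) = k *: (c *m st f).
    by rewrite /st linearZ /= -scalemxAl -scalemxAr.
  have stE' c : c *m st a = (4 * y) *: (c *m st f) - 2 *: (c *m st e).
    have aT : a^T = (4 * y) *: f^T - 2 *: e^T by rewrite linearB /= !linearZ.
    by rewrite /st aT mulmxBl mulmxBr -!scalemxAl -!scalemxAr.
  rewrite stE' stE /g {1}/reflection mulmxBl mul1mx -scalemxAl -mulmxA -/(st e).
  have -> : st e *m reflection f = st e - (2 * y) *: st f.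
    rewrite /reflection mulmxBr mulmx1 -scalemxAr -/(st f).
    rewrite (mulmxA (st e)) st_mul -/y.
    by rewrite mul_scalar_mx scalerA.
  rewrite /reflection -/(st f) mulmxBr -scalemxAr.
  by apply/matrixP => i j; rewrite !mxE; ring.
have trE : \tr g = 2 * x + 2.
  rewrite gE !linearD /= mxtrace_scalar !tr_st /a /b !lformE (lformC f e) -/y.
  by rewrite ee ff xE; ring.
have tr2E : \tr (g *m g) = 4 * x ^+ 2.
  rewrite {2}gE !mulmxDr mulmx1 (mulmxA g e) (mulmxA g f) ge gf.
  rewrite !linearD /= trE !tr_st /a /b !lformE (lformC f e) -/y ee ff xE.
  by ring.
pose N := g *m g - (2 * x) *: g + 1%:M.
have Ne : N *m e = 0.
  rewrite /N mulmxDl mulmxBl mul1mx -scalemxAl -mulmxA ge.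
  rewrite mulmxBr -!scalemxAr ge gf xE.
  by apply/colP => i; rewrite !mxE; ring.
have Nf : N *m f = 0.
  rewrite /N mulmxDl mulmxBl mul1mx -scalemxAl -mulmxA gf.
  rewrite mulmxBr -!scalemxAr ge gf xE.
  by apply/colP => i; rewrite !mxE; ring.
have Ng : N *m g = N.
  by rewrite {1}gE !mulmxDr mulmx1 (mulmxA N e) (mulmxA N f) Ne Nf !mul0mx !addr0.
have Npow m : N *m g ^+ m = N.
  by elim: m => [|m IHm]; rewrite ?mulmx1 // exprS mulmxA Ng.
split=> // m.
have -> : 4 - 4 * x = \tr (N *m g ^+ m).
  rewrite Npow /N mxtraceD raddfB /= mxtraceZ trE tr2E mxtrace_scalar.
  by ring.
rewrite /N mulmxDl mulmxBl mul1mx -scalemxAl mxtraceD raddfB /= mxtraceZ.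
by rewrite -(mulmxA g g) !exprS.
Qed.
End TraceOfPower.

(** * Orthogonal frames *)

Section Frame.
Variables (R : realType) (a b c p : 'cV[R]_4) (A : R).
Local Notation "<< x , y >>" := (lform x y).

(** p is timelike of square norm - A, and not normalised: this avoids the square
    root of A, so that coordinates stay in small fields. *)
Record frame : Prop := Frame {
  frame_aa : <<a, a>> = 1; frame_bb : <<b, b>> = 1; frame_cc : <<c, c>> = 1;
  frame_ab : <<a, b>> = 0; frame_ac : <<a, c>> = 0; frame_bc : <<b, c>> = 0;
  frame_ap : <<a, p>> = 0; frame_bp : <<b, p>> = 0; frame_cp : <<c, p>> = 0;
  frame_pp : <<p, p>> = - A; frame_gt0 : 0 < A }.

Hypothesis F : frame.

Lemma frame_eq x y : <<a, x>> = <<a, y>> -> <<b, x>> = <<b, y>> ->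
  <<c, x>> = <<c, y>> -> <<p, x>> = <<p, y>> -> x = y.
Proof.
case: F => aa bb cc ab ac bc ap bp cp pp A0 ax bx cx px.
have p0 : p != 0.
  by apply: contraTneq A0 => p0; rewrite -[A]opprK -pp p0 lform0l oppr0 ltxx.
have [_ nondeg] := lorentz_frame aa bb cc ab ac bc ap bp cp p0.
apply/eqP; rewrite -subr_eq0; apply/eqP/nondeg; rewrite !lformE.
- by rewrite ax subrr.
- by rewrite bx subrr.
- by rewrite cx subrr.
- by rewrite px subrr.
Qed.

Lemma frame_expand x :
  x = <<a, x>> *: a + <<b, x>> *: b + <<c, x>> *: c - (<<p, x>> / A) *: p.
Proof.
case: (F) => aa bb cc ab ac bc ap bp cp pp A0.
have An0 : A != 0 by rewrite gt_eqF.
apply: frame_eq; rewrite !lformE ?aa ?bb ?cc ?ab ?ac ?bc ?ap ?bp ?cp ?pp;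
  rewrite ?(lformC b a) ?(lformC c a) ?(lformC c b) ?(lformC p a) ?(lformC p b);
  rewrite ?(lformC p c) ?ab ?ac ?bc ?ap ?bp ?cp; by field.
Qed.

Lemma frame_parseval x y : <<x, y>> = <<a, x>> * <<a, y>> +
  <<b, x>> * <<b, y>> + <<c, x>> * <<c, y>> - <<p, x>> * <<p, y>> / A.
Proof. by rewrite {1}(frame_expand x) !lformE; ring. Qed.

(** The identity is the sum of the projectors x x^* / x.x over the frame. *)
Lemma frame_trace (g : 'M[R]_4) : \tr g = <<a, g *m a>> + <<b, g *m b>> +
  <<c, g *m c>> - <<p, g *m p>> / A.
Proof.
pose E (x : 'cV[R]_4) := g *m x *m (x^T *m J31 R).
have trE x : \tr (E x) = <<x, g *m x>>.
  by rewrite /E mxtrace_mulC [LHS]big_ord1.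
rewrite -!trE -(mulrC A^-1) -mxtraceZ -!mxtraceD -raddfB /=; congr (\tr _).
apply: eq_mx_cV => x.
have Ex y : E y *m x = <<y, x>> *: (g *m y).
  rewrite /E -!mulmxA scalemxAr; congr (_ *m _).
  apply/colP => i; rewrite !mxE big_ord1 mulrC; congr (_ * _).
  by rewrite /lform mulmxA.
rewrite mulmxBl !mulmxDl -scalemxAl !Ex {1}(frame_expand x).
rewrite mulmxBr !mulmxDr -!scalemxAr scalerA; congr (_ - _ *: _).
by rewrite mulrC.
Qed.

End Frame.

(** * Rigidity of the Gram matrix *)

(** Consecutive faces v and v' of the lower ring: w' is the upper face that
    meets both, w is the other upper face that meets v, and p, p' are the parts of
    v, v' orthogonal to t. Everything follows by expanding b and p' in the frame
    at v; the section serves for both neighbours of v. *)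
Section Neighbour.
Variables (R : realType) (t w w' p p' b : 'cV[R]_4) (A A' al al' s : R).
Local Notation "<< x , y >>" := (lform x y).
Hypotheses (F : frame t w w' p A) (A'gt0 : 0 < A').
Hypotheses (al2 : al ^+ 2 = A + 1) (al'2 : al' ^+ 2 = A' + 1).
Hypotheses (tp' : <<t, p'>> = 0) (w'p' : <<w', p'>> = 0).
Hypotheses (p'p' : <<p', p'>> = - A') (pp' : <<p, p'>> = - (al * al')).
Hypotheses (tb : <<t, b>> = s) (pb : <<p, b>> = - (s * al)).
Hypotheses (p'b : <<p', b>> = - (s * al')).

Lemma neighbour_prod : <<w, b>> * <<w, p'>> * A = s * al'.
Proof.
have := frame_parseval F b p'.
rewrite (lformC b p') p'b tb tp' w'p' pb pp' => E.
have A0 : A != 0 by rewrite gt_eqF // (frame_gt0 F).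
have : <<w, b>> * <<w, p'>> * A = s * al' * (al ^+ 2 - A).
  apply: (@mulIf _ A^-1); first by rewrite invr_eq0.
  rewrite mulfK //.
  have -> : s * al' * (al ^+ 2 - A) / A = - (s * al') + s * al' * al ^+ 2 / A
    by field.
  by rewrite E; field.
by rewrite al2 => ->; ring.
Qed.

Lemma neighbour_sqr : <<w, p'>> ^+ 2 * A = A + A' + 1.
Proof.
have := frame_parseval F p' p'.
rewrite p'p' tp' w'p' pp' => E.
have A0 : A != 0 by rewrite gt_eqF // (frame_gt0 F).
have : <<w, p'>> ^+ 2 * A = al ^+ 2 * al' ^+ 2 - A * A'.
  apply: (@mulIf _ A^-1); first by rewrite invr_eq0.
  rewrite mulfK //.
  have -> : (al ^+ 2 * al' ^+ 2 - A * A') / A = - A' + (al * al') ^+ 2 / A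
    by field.
  by rewrite E; field.
by rewrite al2 al'2 => ->; ring.
Qed.

Lemma neighbour_relation : <<w, b>> ^+ 2 * A * (A + A' + 1) = s ^+ 2 * (A' + 1).
Proof.
by rewrite -neighbour_sqr -al'2 -exprMn -neighbour_prod; ring.
Qed.

End Neighbour.

Section LobellNormals.
Variables (R : realType) (n : nat).
Local Notation "<< x , y >>" := (lform x y).

(** The facts about a Löbell polyhedron from which its Gram matrix is computed. *)
Record lobell_normals (t b : 'cV[R]_4) (u v : 'Z_n -> 'cV[R]_4) : Prop :=
  LobellNormals {
    lobell_tt : <<t, t>> = 1;
    lobell_bb : <<b, b>> = 1;
    lobell_uu : forall i, <<u i, u i>> = 1;
    lobell_vv : forall i, <<v i, v i>> = 1;
    lobell_tu : forall i, <<t, u i>> = 0;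
    lobell_bv : forall i, <<b, v i>> = 0;
    lobell_uS : forall i, <<u i, u (i + 1)>> = 0;
    lobell_vS : forall i, <<v i, v (i + 1)>> = 0;
    lobell_uv : forall i, <<u i, v i>> = 0;
    lobell_uvS : forall i, <<u i, v (i + 1)>> = 0;
    lobell_vt : forall i, v i <> t /\ v i <> - t;
    lobell_inj : forall i j, i <> j -> v i <> v j /\ v i <> - v j }.

Section Rigidity.
Variables (t b : 'cV[R]_4) (u v : 'Z_n -> 'cV[R]_4).
Hypothesis L : lobell_normals t b u v.

Let al i := <<t, v i>>.
Let s := <<t, b>>.
Let p i := v i - al i *: t.
Let A i := al i ^+ 2 - 1.

Let al2 i : al i ^+ 2 = A i + 1. Proof. by rewrite /A subrK. Qed.

Let tp i : <<t, p i>> = 0.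
Proof. by rewrite /p !lformE (lobell_tt L) mulr1 subrr. Qed.

Let pp i : <<p i, p i>> = - A i.
Proof.
rewrite {1}/p lformDl lformNl lformZl tp mulr0 subr0 /p !lformE (lobell_vv L) (lformC _ t).
by rewrite -/(al i) /A; ring.
Qed.

Let up i : <<u i, p i>> = 0.
Proof.
by rewrite /p !lformE (lobell_uv L) (lformC _ t) (lobell_tu L) mulr0 subr0.
Qed.

Let upS i : <<u i, p (i + 1)>> = 0.
Proof.
by rewrite /p !lformE (lobell_uvS L) (lformC _ t) (lobell_tu L) mulr0 subr0.
Qed.

Let ppS i : <<p i, p (i + 1)>> = - (al i * al (i + 1)).
Proof.
rewrite {1}/p lformDl lformNl lformZl tp mulr0 subr0 /p !lformE (lobell_vS L) (lformC _ t).
by rewrite -/(al i) /A; ring.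
Qed.

Let pb i : <<p i, b>> = - (s * al i).
Proof. by rewrite /p !lformE (lformC _ b) (lobell_bv L) -/s; ring. Qed.

(** p i is not 0 as the faces of t and v i lie in distinct planes, and then it is
    timelike, being orthogonal to three orthonormal vectors. *)
Lemma lobell_frame i : frame t (u (i - 1)) (u i) (p i) (A i).
Proof.
have um1 : <<u (i - 1), p i>> = 0 by rewrite -{2}(subrK 1 i) upS.
have uu1 : <<u (i - 1), u i>> = 0 by rewrite -{2}(subrK 1 i) (lobell_uS L).
have [[tt uu] tu] := (lobell_tt L, lobell_uu L, lobell_tu L).
apply: (Frame tt (uu _) (uu _) (tu _) (tu _) uu1 (tp _) um1 (up _) (pp _)).
have p0 : p i != 0.
  apply/eqP => pi0; have := pp i; rewrite pi0 lform0l => /esym/eqP.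
  rewrite oppr_eq0 /A subr_eq0 sqrf_eq1 => al1.
  move: pi0 => /eqP; rewrite subr_eq0 => /eqP vE.
  have [vt vNt] := lobell_vt L i.
  by case/orP: al1 vE => /eqP ->; rewrite ?scale1r ?scaleN1r.
have [] := lorentz_frame tt (uu _) (uu _) (tu _) (tu _) uu1 (tp _) um1 (up _) p0.
by rewrite pp oppr_lt0.
Qed.

Let A_gt0 i : 0 < A i. Proof. exact: frame_gt0 (lobell_frame i). Qed.

Let AA_gt0 i j : 0 < A i + A j + 1.
Proof. exact: addr_gt0 (addr_gt0 (A_gt0 i) (A_gt0 j)) ltr01. Qed.

Let frameC i : frame t (u i) (u (i - 1)) (p i) (A i).
Proof. by case: (lobell_frame i) => *; apply: Frame => //; rewrite lformC. Qed.

Let next i : <<u (i - 1), b>> ^+ 2 * A i * (A i + A (i + 1) + 1)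
  = s ^+ 2 * (A (i + 1) + 1).
Proof.
by apply: (neighbour_relation (lobell_frame i) (al2 i) (al2 _) (tp _)
  (upS i) (pp _) (ppS i) _ (pb i) (pb _)).
Qed.

Let prev i : <<u i, b>> ^+ 2 * A i * (A i + A (i - 1) + 1)
  = s ^+ 2 * (A (i - 1) + 1).
Proof.
apply: (neighbour_relation (frameC i) (al2 i) (al2 _) (tp _)
  (up (i - 1)) (pp _) _ _ (pb i) (pb _)) => //.
by rewrite lformC; have := ppS (i - 1); rewrite subrK mulrC.
Qed.

(** The norm of b in the frame at i. *)
Let bottom i : <<u (i - 1), b>> ^+ 2 + <<u i, b>> ^+ 2 - s ^+ 2 / A i = 1.
Proof.
have := frame_parseval (lobell_frame i) b b; rewrite (lobell_bb L) pb -/s => ->.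
have An0 : A i != 0 by rewrite gt_eqF.
have -> : - (s * al i) * - (s * al i) / A i = s ^+ 2 * al i ^+ 2 / A i.
  by field.
by rewrite al2; field.
Qed.

(** If t.b = 0, then b is orthogonal to the whole frame at 0. *)
Let s2_gt0 : 0 < s ^+ 2.
Proof.
rewrite lt_def sqr_ge0 andbT; apply/eqP => s0.
have z x j : x ^+ 2 * A 0 * (A 0 + A j + 1) = s ^+ 2 * (A j + 1) -> x ^+ 2 = 0.
  rewrite s0 mul0r => /eqP; rewrite -[X in X == _]mulrA mulf_eq0 orbC.
  by rewrite (gt_eqF (mulr_gt0 (A_gt0 0) (AA_gt0 0 j))) /= => /eqP.
have := bottom 0; rewrite (z _ _ (next 0)) (z _ _ (prev 0)) s0.
by rewrite mul0r !addr0 subr0 => /esym/eqP; rewrite oner_eq0.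
Qed.

(** The right-hand side increases with the heights of the neighbours of i, which
    makes the maximum principle applicable. *)
Let height_equation i : (s ^+ 2)^-1
  = (A i)^-1 - (A i + A (i + 1) + 1)^-1 - (A i + A (i - 1) + 1)^-1.
Proof.
have := bottom i; have := next i; have := prev i.
move: (A_gt0 i) (A_gt0 (i + 1)) (A_gt0 (i - 1)) s2_gt0.
move: (A i) (A (i + 1)) (A (i - 1)) (s ^+ 2) => a a1 a2 S a0 a10 a20 S0.
set y := _ ^+ 2; set x := _ ^+ 2 => E2 E1 E.
have d1 : a + a1 + 1 != 0 by rewrite gt_eqF // !addr_gt0.
have d2 : a + a2 + 1 != 0 by rewrite gt_eqF // !addr_gt0.
have [an0 Sn0] : a != 0 /\ S != 0 by rewrite !gt_eqF.
have xE : x = S * (a1 + 1) / (a * (a + a1 + 1)).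
  by rewrite -E1; field; rewrite an0 d1.
have yE : y = S * (a2 + 1) / (a * (a + a2 + 1)).
  by rewrite -E2; field; rewrite an0 d2.
apply: (@mulfI _ S) => //; rewrite mulfV // -[X in X = _]E xE yE.
by field; rewrite an0 d1 d2.
Qed.

(** At a maximal height M the equation gives 1 / s^2 <= 1 / (M (2 M + 1)), and at
    a minimal height m the opposite inequality, so M (2 M + 1) <= m (2 m + 1). *)
Lemma lobell_rigidity : exists2 a : R, 0 < a &
  [/\ forall i, <<t, v i>> ^+ 2 = a + 1, <<t, b>> ^+ 2 = a * (2 * a + 1)
    & forall i, <<u i, b>> ^+ 2 = a + 1].
Proof.
have le_inv (x y : R) : 0 < x -> x <= y -> y^-1 <= x^-1.
  by move=> x0 xy; rewrite lef_pV2 // posrE (lt_le_trans x0).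
have frac (x : R) : 0 < x ->
    x^-1 - (x + x + 1)^-1 - (x + x + 1)^-1 = (x * (2 * x + 1))^-1.
  move=> x0; have d : 2 * x + 1 != 0 by rewrite gt_eqF // addr_gt0 ?mulr_gt0.
  have d' : x + x + 1 = 2 * x + 1 by ring.
  by rewrite d'; field; rewrite d gt_eqF.
have [M _ maxM] := @arg_maxP _ R _ (0 : 'Z_n) xpredT A isT.
have [m _ minm] := @arg_minP _ R _ (0 : 'Z_n) xpredT A isT.
have {}maxM j : A j <= A M by exact: maxM.
have {}minm j : A m <= A j by exact: minm.
have sM : (s ^+ 2)^-1 <= (A M * (2 * A M + 1))^-1.
  rewrite (height_equation M) -(frac (A M) (A_gt0 M)); apply: lerB; first apply: lerB => //.
    by apply: le_inv; rewrite ?AA_gt0 // lerD2r lerD2l maxM.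
  by apply: le_inv; rewrite ?AA_gt0 // lerD2r lerD2l maxM.
have sm : (A m * (2 * A m + 1))^-1 <= (s ^+ 2)^-1.
  rewrite (height_equation m) -(frac (A m) (A_gt0 m)); apply: lerB; first apply: lerB => //.
    by apply: le_inv; rewrite ?AA_gt0 // lerD2r lerD2l minm.
  by apply: le_inv; rewrite ?AA_gt0 // lerD2r lerD2l minm.
have pos i : 0 < A i * (2 * A i + 1).
  by have := A_gt0 i; move: (A i) => a a0; apply: mulr_gt0 => //; lra.
move: sM sm; rewrite !lef_pV2 ?posrE // => sM sm.
have Mm : A M <= A m.
  have := le_trans sM sm; have := A_gt0 M; have := A_gt0 m.
  by move: (A M) (A m) => x y; nra.
have AE i : A i = A m.
  by apply: le_anti; rewrite minm // (le_trans (maxM i) Mm).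
exists (A m) => //; split=> [i||i].
- by rewrite -/(al i) al2 AE.
- by apply: le_anti; rewrite -/s sm -(AE M) sM.
- have := prev i; rewrite !AE.
  have -> : s ^+ 2 = A m * (2 * A m + 1).
    by apply: le_anti; rewrite -/s sm -(AE M) sM.
  have -> : A m + A m + 1 = 2 * A m + 1 by ring.
  rewrite -mulrA [RHS]mulrC; apply: mulIf.
  by rewrite gt_eqF.
Qed.

End Rigidity.
End LobellNormals.

(** * The ring of frames *)

Section NormalizedNormals.
Variables (R : realType) (n : nat).
Local Notation "<< x , y >>" := (lform x y).

(** The shape that the Gram matrix takes once the signs of u i and v i are chosen
    suitably, which does not affect the reflections. *)
Record normalized_normals (A s tau : R) (t b : 'cV[R]_4) (u v : 'Z_n -> 'cV[R]_4)
    : Prop := NormalizedNormals {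
  normalized_lobell : lobell_normals t b u v;
  normalized_gt0 : 0 < A;
  normalized_tau : tau ^+ 2 = A + 1;
  normalized_s : s ^+ 2 = A * (2 * A + 1);
  normalized_tv : forall i, <<t, v i>> = tau;
  normalized_tb : <<t, b>> = s;
  normalized_ub : forall i, <<u i, b>> = tau }.

Lemma normalization t b u v : lobell_normals t b u v ->
  exists A s tau eu ev,
    [/\ normalized_normals A s tau t b (fun i : 'Z_n => eu i *: u i)
          (fun i => ev i *: v i),
        forall i, eu i ^+ 2 = 1 & forall i, ev i ^+ 2 = 1].
Proof.
move=> L; have [A A0 [tv tb ub]] := lobell_rigidity L.
pose tau := Num.sqrt (A + 1).
have tau2 : tau ^+ 2 = A + 1 by rewrite sqr_sqrtr // addr_ge0 // ltW.
pose sg (x : R) : R := if x == tau then 1 else -1.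
have sg2 x : sg x ^+ 2 = 1 by rewrite /sg; case: ifP; rewrite ?sqrrN expr1n.
have sgx x : x ^+ 2 = A + 1 -> sg x * x = tau.
  rewrite -tau2 => /eqP; rewrite eqf_sqr /sg; have [-> _|_ /= /eqP ->] := eqVneq.
    by rewrite mul1r.
  by rewrite mulN1r opprK.
have sgE x (y z : 'cV[R]_4) : sg x *: y = z -> y = sg x *: z.
  by move=> <-; rewrite scalerA -expr2 sg2 scale1r.
have sg_cases x (y : 'cV[R]_4) : sg x *: y = y \/ sg x *: y = - y.
  by rewrite /sg; case: ifP => _; [left; rewrite scale1r|right; rewrite scaleN1r].
exists A, <<t, b>>, tau, (fun i => sg <<u i, b>>), (fun i => sg <<t, v i>>).
split=> //; split=> // [|i|i]; last 2 first.
- by rewrite lformZr sgx.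
- by rewrite lformZl sgx.
case: (L) => tt bb uu vv tu bv uS vS uv uvS vt inj.
split=> // [i|i|i|i|i|i|i|i|i|i j ij]; rewrite ?lformZl ?lformZr.
- by rewrite uu mulr1 -expr2 sg2.
- by rewrite vv mulr1 -expr2 sg2.
- by rewrite tu mulr0.
- by rewrite bv mulr0.
- by rewrite uS !mulr0.
- by rewrite vS !mulr0.
- by rewrite uv !mulr0.
- by rewrite uvS !mulr0.
- have [vt1 vt2] := vt i; split=> /sgE.
    by have [->|->] := sg_cases <<t, v i>> t.
  by rewrite scalerN; have [->|->] := sg_cases <<t, v i>> t; rewrite ?opprK.
- have [ij1 ij2] := inj _ _ ij; split=> /sgE.
    have [->|->] := sg_cases <<t, v j>> (v j);
      [have [->|->] := sg_cases <<t, v i>> (v j)|rewrite scalerN;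
       have [->|->] := sg_cases <<t, v i>> (v j)]; rewrite ?opprK //.
  have [->|->] := sg_cases <<t, v j>> (v j);
    [rewrite scalerN; have [->|->] := sg_cases <<t, v i>> (v j)|rewrite opprK;
     have [->|->] := sg_cases <<t, v i>> (v j)]; rewrite ?opprK //.
Qed.

Section Consequences.
Variables (A s tau : R) (t b : 'cV[R]_4) (u v : 'Z_n -> 'cV[R]_4).
Hypothesis N : normalized_normals A s tau t b u v.

Let L := normalized_lobell N.
Let A0 := normalized_gt0 N.
Variable p : 'Z_n -> 'cV[R]_4.
Hypothesis pE : forall i, p i = v i - tau *: t.

Lemma normalized_A_neq0 : A != 0. Proof. by rewrite gt_eqF // A0. Qed.

Lemma normalized_A1_neq0 : A + 1 != 0.
Proof. by rewrite gt_eqF // addr_gt0 // A0. Qed.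

Lemma normalized_s_neq0 : s != 0.
Proof.
rewrite -sqrf_eq0 (normalized_s N) gt_eqF //.
by rewrite mulr_gt0 ?addr_gt0 ?mulr_gt0 ?A0.
Qed.

Lemma normalized_tau_neq0 : tau != 0.
Proof. by rewrite -sqrf_eq0 (normalized_tau N) normalized_A1_neq0. Qed.

Let An0 := normalized_A_neq0.
Let sn0 := normalized_s_neq0.

Lemma normalized_frame i : frame t (u (i - 1)) (u i) (p i) A.
Proof.
have := lobell_frame L i.
by rewrite (normalized_tv N) (normalized_tau N) addrK -pE.
Qed.

Let pb i : <<p i, b>> = - (s * tau).
Proof.
rewrite pE !lformE (normalized_tb N) (lformC _ b) (lobell_bv L) sub0r.
by rewrite mulrC.
Qed.

Let pp i : <<p i, p i>> = - A.
Proof. exact: frame_pp (normalized_frame i). Qed.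

Let tp i : <<t, p i>> = 0.
Proof. exact: frame_ap (normalized_frame i). Qed.

Let up i : <<u i, p i>> = 0.
Proof. exact: frame_cp (normalized_frame i). Qed.

Let upS i : <<u i, p (i + 1)>> = 0.
Proof. by have := frame_bp (normalized_frame (i + 1)); rewrite addrK. Qed.

Let ppS i : <<p i, p (i + 1)>> = - (A + 1).
Proof.
rewrite !pE !lformE (lobell_vS L) (lobell_tt L) (lformC _ t) !(normalized_tv N).
by rewrite -(normalized_tau N); ring.
Qed.

Let ppS' i : <<p i, p (i + 1)>> = - (tau * tau).
Proof. by rewrite ppS -(normalized_tau N) expr2. Qed.

(** As u(i-1).b is constant, the coordinate of p(i+1) on u(i-1) is s / A for
    every i: the passage from one frame to the next does not depend on i. *)
Lemma normalized_next i : s *: u (i - 1) = A *: p (i + 1) - (A + 1) *: p i.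
Proof.
have F := normalized_frame i.
have tau2 := normalized_tau N.
have := neighbour_prod F tau2 (tp _) (upS i) (ppS' i) (normalized_tb N) (pb i) (pb _).
rewrite (normalized_ub N) => E.
have {}E : <<u (i - 1), p (i + 1)>> * A = s.
  by apply: (mulfI normalized_tau_neq0); rewrite mulrA E mulrC.
case: (F) => aa bb cc ab ac bc ap bp cp _ _.
apply: (frame_eq F); rewrite !lformE ?ab ?ap ?bb ?bp ?cp ?tp ?upS ?pp ?ppS.
- by ring.
- by rewrite -E; ring.
- by rewrite (lformC (u i)) bc; ring.
- by rewrite (lformC (p i)) bp; ring.
Qed.

Lemma normalized_prev i : s *: u i = A *: p (i - 1) - (A + 1) *: p i.
Proof.
have F : frame t (u i) (u (i - 1)) (p i) A.
  by case: (normalized_frame i) => *; apply: Frame => //; rewrite lformC.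
have tau2 := normalized_tau N.
have ppP : <<p i, p (i - 1)>> = - (tau * tau).
  by have := ppS' (i - 1); rewrite subrK lformC.
have := neighbour_prod F tau2 (tp _) (up (i - 1)) ppP (normalized_tb N) (pb i) (pb _).
rewrite (normalized_ub N) => E.
have {}E : <<u i, p (i - 1)>> * A = s.
  by apply: (mulfI normalized_tau_neq0); rewrite mulrA E mulrC.
case: (F) => aa bb cc ab ac bc ap bp cp _ _.
apply: (frame_eq F); rewrite !lformE ?ab ?ap ?bb ?bp ?cp ?tp ?up ?pp ?ppP.
- by ring.
- by rewrite -E; ring.
- by rewrite (lformC _ (u i)) bc; ring.
- by rewrite (lformC (p i)) bp -tau2; ring.
Qed.

(** s u(i) and s u(i+2) are both combinations of p(i+1) and p(i+2). *)
Lemma normalized_uu2 i : <<u i, u (i + 1 + 1)>> = - (A + 1) / A.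
Proof.
have := normalized_next (i + 1); have := normalized_prev (i + 1 + 1).
rewrite !addrK => E2 E1.
apply: (mulfI sn0); apply: (mulfI sn0).
transitivity (lform (s *: u i) (s *: u (i + 1 + 1))); first by rewrite !lformE; ring.
rewrite E1 E2 !lformE !pp ppS (lformC (p (i + 1 + 1))) ppS.
have -> : s * (s * (- (A + 1) / A)) = s ^+ 2 * (- (A + 1) / A) by ring.
by rewrite (normalized_s N); field.
Qed.

(** The vectors with coordinates in K in the orthogonal frame tau t, s u(-1),
    s u(0), p(0) form a K-structure on which the Lorentz form has values in K. It
    contains a multiple of each normal, with a factor whose square is in K, hence
    is preserved by the reflections, as 2 (e.x) e = 2 (e'.x) / k^2 e' for e' = k e. *)
Section RationalStructure.
Variable K : divringClosed R.
Hypothesis KA : A \in K.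

(** Products with the frame vectors are used instead of coordinates: they differ
    by the norms of the frame vectors, which are in K. *)
Definition rational_vector (x : 'cV[R]_4) : bool :=
  [&& tau * <<t, x>> \in K, s * <<u (0 - 1), x>> \in K, s * <<u 0, x>> \in K
    & <<p 0, x>> \in K].

Let KA1 : A + 1 \in K. Proof. by rewrite rpredD ?rpred1 ?KA. Qed.

Let Ks2 : s ^+ 2 \in K.
Proof. by rewrite (normalized_s N) rpredM ?rpredD ?rpredM ?rpred_nat ?KA ?rpred1. Qed.

Lemma rational_lin k x y : k \in K -> rational_vector x -> rational_vector y ->
  rational_vector (k *: x + y).
Proof.
move=> kK /and4P[x1 x2 x3 x4] /and4P[y1 y2 y3 y4]; apply/and4P.
have lin a (z : 'cV[R]_4) :
    a * <<z, k *: x + y>> = k * (a * <<z, x>>) + a * <<z, y>>.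
  by rewrite !lformE; ring.
by rewrite !lin !lformE; split; apply: rpredD => //; apply: rpredM.
Qed.

Lemma rational0 : rational_vector 0.
Proof. by apply/and4P; rewrite !lform0r !mulr0; split; apply: rpred0. Qed.

Lemma rationalZ k x : k \in K -> rational_vector x -> rational_vector (k *: x).
Proof. by move=> kK xK; rewrite -[_ *: _]addr0 rational_lin // rational0. Qed.

Lemma rational_lform x y : rational_vector x -> rational_vector y ->
  <<x, y>> \in K.
Proof.
move=> /and4P[x1 x2 x3 x4] /and4P[y1 y2 y3 y4].
rewrite (frame_parseval (normalized_frame 0) x y).
have -> : <<t, x>> * <<t, y>> = (tau * <<t, x>>) * (tau * <<t, y>>) / (A + 1).
  rewrite -(normalized_tau N); field; exact: normalized_tau_neq0.
have sE a a' : a * a' = (s * a) * (s * a') / s ^+ 2 by field; exact: sn0.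
rewrite (sE <<u 0, x>>) (sE <<u (0 - 1), x>>).
have KV a a' c : a \in K -> a' \in K -> c \in K -> a * a' / c \in K.
  by move=> aK a'K cK; apply: rpredM; [apply: rpredM|rewrite rpredV].
apply: rpredB; last exact: KV.
by apply: rpredD; [apply: rpredD|]; apply: KV; rewrite ?KA1 ?Ks2.
Qed.

Lemma rational_t : rational_vector (tau *: t).
Proof.
have F := normalized_frame 0.
apply/and4P; rewrite !lformZr (lobell_tt L) !(lformC _ t) !(lobell_tu L) tp.
by rewrite mulr1 -expr2 (normalized_tau N) !mulr0 rpred0; split.
Qed.

Lemma rational_b : rational_vector ((tau / s) *: b).
Proof.
apply/and4P; rewrite !lformZr (normalized_tb N) !(normalized_ub N) pb.
have E1 : tau * (tau / s * s) = A + 1 by rewrite -(normalized_tau N); field.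
have E2 : s * (tau / s * tau) = A + 1 by rewrite -(normalized_tau N); field.
have E3 : tau / s * - (s * tau) = - (A + 1).
  by rewrite -(normalized_tau N); field.
by rewrite E1 E2 E3 rpredN; split.
Qed.

(** By induction along the ring: each frame is a K-combination of the previous
    one. *)
Lemma rational_pu i : [/\ rational_vector (p i), rational_vector (s *: u (i - 1))
  & rational_vector (s *: u i)].
Proof.
rewrite -(natr_Zp i); elim: (i : nat) => [|m [IHp IHu' IHu]].
  have F := normalized_frame 0.
  case: (F) => aa bb cc ab ac bc ap bp cp _ _.
  split; apply/and4P; rewrite ?lformZr ?pp ?aa ?bb ?cc ?ab ?ac ?bc ?ap ?bp ?cp;
  rewrite ?(lformC (u 0) (u (0 - 1))) ?(lformC (p 0)) ?bc ?bp ?cp ?mulr0 ?mulr1;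
  by rewrite ?rpred0 -?expr2 ?rpredN; split.
have pS : rational_vector (p (m.+1)%:R).
  have -> : p (m.+1)%:R = A^-1 *: (s *: u (m%:R - 1) + (A + 1) *: p m%:R).
    rewrite normalized_next subrK scalerA mulVf ?normalized_A_neq0 //.
    by rewrite scale1r -natr1.
  rewrite rationalZ ?rpredV // -[X in X + _]scale1r rational_lin ?rpred1 //.
  by rewrite rationalZ.
split=> //; first by rewrite -natr1 addrK.
rewrite normalized_prev -{1}natr1 addrK rational_lin // -scaleNr.
by rewrite rationalZ // rpredN.
Qed.

Lemma rational_v i : rational_vector (v i).
Proof.
have -> : v i = 1 *: (tau *: t) + p i by rewrite scale1r pE addrC subrK.
by rewrite rational_lin ?rpred1 ?rational_t //; case: (rational_pu i).
Qed.

(** The condition on the inverse makes these isometries a group at once. *)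
Definition rational_isometry (g : 'M[R]_4) : Prop :=
  [/\ IsomH3 g, forall x, rational_vector x -> rational_vector (g *m x)
    & forall x, rational_vector x -> rational_vector (invmx g *m x)].

Lemma rational_isometry_subgroup : is_subgroup rational_isometry.
Proof.
split=> [g []//||g h [gI gK gVK] [hI hK hVK]|g [gI gK gVK]].
- by split; [exact: IsomH3_1| |] => x; rewrite ?invmx1 mul1mx.
- split=> [|x xK|x xK]; first exact: IsomH3_mul.
    by rewrite -mulmxA; apply/gK/hK.
  have -> : invmx (g *m h) = invmx h *m invmx g.
    have [gU hU] := (IsomH3_unit gI, IsomH3_unit hI).
    have ghU : g *m h \in unitmx by rewrite unitmx_mul gU.
    apply: (can_inj (mulKmx ghU)); rewrite mulmxV // mulmxA mulmxK //.
    by rewrite mulmxV.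
  by rewrite -mulmxA; apply/hVK/gVK.
- by split=> //; [exact: IsomH3_inv | rewrite invmxK].
Qed.

Lemma rational_reflection k e : lform e e = 1 -> k != 0 -> k ^+ 2 \in K ->
  rational_vector (k *: e) -> rational_isometry (reflection e).
Proof.
move=> ee k0 kK eK.
have eI : forall x, rational_vector x -> rational_vector (reflection e *m x).
  move=> x xK; rewrite reflectionE.
  have -> : x - (2 * <<e, x>>) *: e
      = (- (2 * <<k *: e, x>> / k ^+ 2)) *: (k *: e) + x.
    rewrite lformZl scalerA addrC -scaleNr; congr (_ *: _ + _).
    by field.
  rewrite rational_lin // rpredN !rpredM ?rpredV ?rpred_nat //.
  exact: rational_lform.
split; [exact: reflection_IsomH3|exact: eI|].
have eU := IsomH3_unit (reflection_IsomH3 ee).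
suff -> : invmx (reflection e) = reflection e by [].
by apply: (can_inj (mulKmx eU)); rewrite mulmxV // reflectionK.
Qed.

Lemma rational_trace g : rational_isometry g -> \tr g \in K.
Proof.
move=> [_ gK _]; rewrite (frame_trace (normalized_frame 0)).
have scal k e : k != 0 -> k ^+ 2 \in K -> rational_vector (k *: e) ->
    <<e, g *m e>> \in K.
  move=> k0 kK eK; have -> : <<e, g *m e>> = <<k *: e, g *m (k *: e)>> / k ^+ 2.
    by rewrite -scalemxAr !lformE; field.
  by rewrite rpredM ?rpredV // rational_lform // gK.
have [pK u'K uK] := rational_pu 0.
have Ktau : tau ^+ 2 \in K by rewrite (normalized_tau N) KA1.
apply: rpredB.
  apply: rpredD; first apply: rpredD.
  - exact: (scal tau t normalized_tau_neq0 Ktau rational_t).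
  - exact: (scal s _ sn0).
  - exact: (scal s _ sn0).
by apply: rpredM; [apply: rational_lform => //; apply: gK|rewrite rpredV].
Qed.

End RationalStructure.
End Consequences.
End NormalizedNormals.

(** * The angle of the ring *)

Section Trigonometry.
Variable R : realType.
Implicit Types x y : R.

Lemma cosD2pin x k : cos (x + k%:R * (2 * pi)) = cos x.
Proof.
have -> : k%:R * (2 * pi) = pi *+ 2 *+ k :> R.
  by rewrite -[RHS]mulr_natl -[pi *+ 2]mulr_natl.
exact: (periodicn (@cosD2pi R)).
Qed.

Lemma sinD2pin x k : sin (x + k%:R * (2 * pi)) = sin x.
Proof.
have -> : k%:R * (2 * pi) = pi *+ 2 *+ k :> R.
  by rewrite -[RHS]mulr_natl -[pi *+ 2]mulr_natl.
exact: (periodicn (@sinD2pi R)).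
Qed.

Lemma cos_eq1 x : 0 <= x -> cos x = 1 -> exists k : nat, x = k%:R * (2 * pi).
Proof.
move=> x0 cx; have pi0 : 0 < 2 * pi :> R by rewrite mulr_gt0 ?pi_gt0.
have q0 : 0 <= x / (2 * pi) by rewrite divr_ge0 // ltW.
exists (Num.trunc (x / (2 * pi))); have /andP[] := truncn_itv q0.
set k := Num.trunc _; rewrite ler_pdivlMr // ltr_pdivrMr // => kx xk.
pose y := x - k%:R * (2 * pi).
have y0 : 0 <= y by rewrite subr_ge0.
have y2pi : y < 2 * pi by rewrite ltrBlDl -[X in _ + X]mul1r -mulrDl natr1.
have cy : cos y = 1 by rewrite -(cosD2pin y k) subrK.
have sy : sin (y / 2) = 0.
  apply/eqP; rewrite -sqrf_eq0 sin2cos2.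
  have := cos_mulr2n (y / 2); rewrite -(mulr_natr (y / 2)) divfK ?pnatr_eq0 // cy => E.
  by apply/eqP; move: E; rewrite mulr2n; lra.
apply/eqP; rewrite -subr_eq0 -/y eq_le y0 andbT leNgt; apply/negP => yp.
have := @sin_gt0_pi R (y / 2).
rewrite sy ltxx divr_gt0 //= ltr_pdivrMr // mulrC y2pi.
by move=> /(_ isT).
Qed.

Lemma cos_recurrence x m :
  cos (m.+2%:R * x) = 2 * cos x * cos (m.+1%:R * x) - cos (m%:R * x).
Proof.
have -> : m.+2%:R * x = m.+1%:R * x + x by rewrite -natr1; ring.
have -> : m%:R * x = m.+1%:R * x - x by rewrite -natr1; ring.
by rewrite cosD cosB; ring.
Qed.

Lemma sin_recurrence x y m :
  sin (m.+2%:R * x + y) = 2 * cos x * sin (m.+1%:R * x + y) - sin (m%:R * x + y).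
Proof.
have -> : m.+2%:R * x + y = (m.+1%:R * x + y) + x by rewrite -natr1; ring.
have -> : m%:R * x + y = (m.+1%:R * x + y) - x by rewrite -natr1; ring.
by rewrite sinD sinB; ring.
Qed.

Lemma nat_ind2 (P : nat -> Prop) : P 0 -> P 1%N ->
  (forall m, P m -> P m.+1 -> P m.+2) -> forall m, P m.
Proof.
move=> P0 P1 PS m; suff [] : P m /\ P m.+1 by [].
by elim: m => [//|m [IHm IHm1]]; split=> //; apply: PS.
Qed.

End Trigonometry.

Section Angle.
Variables (R : realType) (n : nat).
Variables (A s tau : R) (t b : 'cV[R]_4) (u v : 'Z_n -> 'cV[R]_4).
Hypothesis N : normalized_normals A s tau t b u v.
Hypothesis n_gt1 : (1 < n)%N.
Local Notation "<< x , y >>" := (lform x y).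

(** The vectors D m = p(m+1) - p(m) satisfy D(m+2) = 2 c D(m+1) - D m. Their
    products with D 0 are a scalar solution starting with 2, 2 c; were c >= 1, all
    of them would be at least 2, but their sum over a period is 0. So
    c = cos th, the products are 2 cos (m th), and periodicity gives
    n th = 2 pi K. If m = n / gcd(K, n), then D has period m, so p(j+m) - p(j)
    is a constant w; a multiple of w is 0, so p(m) = p(0) and m = n. *)
Lemma normalized_angle : exists k, [/\ coprime k n,
  (2 * A)^-1 = cos (k%:R * (2 * pi / n%:R)) & 0 < (2 * A)^-1 < 1].
Proof.
have [p pE] : {p | forall i, p i = v i - tau *: t}.
  by exists (fun i => v i - tau *: t).
have An0 := normalized_A_neq0 N; have A0 := normalized_gt0 N.
have L := normalized_lobell N.
have next := normalized_next N pE; have prev := normalized_prev N pE.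
pose P (m : nat) := p m%:R.
have [D DE] : {D | forall m, D m = P m.+1 - P m} by exists (fun m => P m.+1 - P m).
have natZ m : m.+1%:R = m%:R + 1 :> 'Z_n by rewrite natr1.
have Pn m : P (m + n)%N = P m by rewrite /P natrD pchar_Zp // addr0.
have natB m : m.+1%:R - 1 = m%:R :> 'Z_n by rewrite natZ addrK.
have nextN m : s *: u m.+1%:R = A *: P m.+3 - (A + 1) *: P m.+2.
  by have := next m.+2%:R; rewrite natB -natZ.
have prevN m : s *: u m.+1%:R = A *: P m - (A + 1) *: P m.+1.
  by have := prev m.+1%:R; rewrite natB.
have DS m : D m.+2 = A^-1 *: D m.+1 - D m.
  have E : A *: P m.+3 - (A + 1) *: P m.+2 = A *: P m - (A + 1) *: P m.+1.
    by rewrite -nextN prevN.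
  apply: (scalerI An0); rewrite scalerBr scalerA mulfV // scale1r.
  rewrite !DE; apply/eqP; rewrite -subr_eq0; apply/eqP.
  transitivity ((A *: P m.+3 - (A + 1) *: P m.+2)
                - (A *: P m - (A + 1) *: P m.+1)).
    by apply/colP => i; rewrite !mxE; ring.
  by rewrite E subrr.
have PP m : <<P m, P m>> = - A by exact: frame_pp (normalized_frame N pE _).
have PPS m : <<P m, P m.+1>> = - (A + 1).
  rewrite /P natZ !pE !lformE (lobell_vS L) (lobell_tt L) (lformC _ t).
  by rewrite !(normalized_tv N) -(normalized_tau N); ring.
have PP2 : <<P 0, P 2>> = - (A + 1) ^+ 2 / A.
  have up := frame_cp (normalized_frame N pE 0).
  have := congr1 (lform (P 0)) (next 1); rewrite subrr lformZr lformC.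
  have -> : 1 + 1 = 2%:R :> 'Z_n by rewrite natZ.
  rewrite -[p 2%:R]/(P 2) -[p 1]/(P 1%N) -[P 0]/(p 0) up mulr0.
  rewrite -/(P 0) !lformE PPS => E; apply: (mulfI An0).
  by move/eqP: E; rewrite eq_sym subr_eq0 => /eqP ->; field.
pose g m := <<D m, D 0%N>>.
have g0 : g 0%N = 2 by rewrite /g !DE !lformE !PP !(lformC (P 1)) PPS; ring.
have g1 : g 1%N = A^-1.
  rewrite /g !DE !lformE !PP !(lformC (P 2)) (lformC (P 1) (P 0)) !PPS PP2.
  by field.
have gS m : g m.+2 = A^-1 * g m.+1 - g m by rewrite /g DS !lformE.
set c := (2 * A)^-1.
have c0 : 0 < c by rewrite invr_gt0 mulr_gt0.
have cA : A^-1 = 2 * c by rewrite /c; field.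
have tele m : \sum_(j < m) D j = P m - P 0.
  elim: m => [|m IHm]; first by rewrite big_ord0 subrr.
  by rewrite big_ord_recr IHm DE /= addrC addrA subrK.
have sum_g : \sum_(j < n) g j = 0.
  have -> : \sum_(j < n) g j = <<\sum_(j < n) D j, D 0>>.
    elim/big_rec2: _ => [|j x y _ ->]; first by rewrite lform0l.
    by rewrite lformDl.
  by rewrite tele -[n in P n]add0n Pn subrr lform0l.
have c1 : c < 1.
  rewrite ltNge; apply/negP => c1.
  have mono : forall m, 2 <= g m /\ g m <= g m.+1.
    elim=> [|m [IH1 IH2]]; first by rewrite g0 g1 cA; split; lra.
    split; first exact: le_trans IH2.
    by rewrite gS cA; nra.
  have : \sum_(j < n) (2 : R) <= \sum_(j < n) g j.
    by apply: ler_sum => j _; case: (mono j).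
  by rewrite sum_g sumr_const card_ord leNgt pmulrn_lgt0 ?ltr0n // ltnW.
pose th := acos c.
have cth : cos th = c by rewrite acosK // in_itv /= (ltW c1) andbT; lra.
have th0 : 0 < th by rewrite acos_gt0 // c1 andbT; lra.
have thpi : th < pi by rewrite acos_ltpi // (ltW c1) andbT; lra.
have sth : sin th != 0 by rewrite gt_eqF // sin_gt0_pi // th0.
(* (D m . D 0) and 2 cos (m th) satisfy the same recurrence. *)
have gcos m : g m = 2 * cos (m%:R * th).
  elim/nat_ind2: m => [||m IH1 IH2].
  - by rewrite g0 mul0r cos0 mulr1.
  - by rewrite g1 cA mul1r cth.
  - by rewrite gS cos_recurrence cth cA IH1 IH2; ring.
have [K nth] : exists k : nat, n%:R * th = k%:R * (2 * pi).
  apply: cos_eq1; first by rewrite mulr_ge0 // ltW.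
  have : g n = g 0%N.
    by rewrite /g !DE -[P n]/(P (0 + n)%N) -[P n.+1]/(P (1 + n)%N) !Pn.
  rewrite gcos gcos mul0r cos0; lra.
have n0 : n%:R != 0 :> R by rewrite pnatr_eq0 -lt0n ltnW.
exists K; split; last by rewrite c0.
  pose d := gcdn K n; pose m := (n %/ d)%N.
  have nE : n = (m * d)%N by rewrite divnK // dvdn_gcdr.
  have KE : K = (K %/ d * d)%N by rewrite divnK // dvdn_gcdl.
  have d0 : (0 < d)%N by rewrite gcdn_gt0 orbC ltnW.
  have mth : m%:R * th = (K %/ d)%:R * (2 * pi).
    have : d%:R != 0 :> R by rewrite pnatr_eq0 -lt0n.
    move=> /mulIf; apply; rewrite mulrAC -natrM -nE nth [in LHS]KE natrM.
    by ring.
  have Dm j : sin th *: D j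
      = sin (j%:R * th) *: D 1%N - sin (j%:R * th + - th) *: D 0%N.
    elim/nat_ind2: j => [||j IH1 IH2].
    - by rewrite mul0r sin0 scale0r !add0r sinN scaleNr opprK.
    - by rewrite mul1r subrr sin0 scale0r subr0.
    - have -> : sin th *: D j.+2
          = (2 * cos th) *: (sin th *: D j.+1) - sin th *: D j.
        by rewrite DS cA cth scalerBr !scalerA mulrC.
      rewrite IH1 IH2 sin_recurrence.
      have := sin_recurrence th 0 j; rewrite !addr0 => ->.
      by apply/colP => i; rewrite !mxE; ring.
  (* m th is a multiple of 2 pi. *)
  have Dper j : D (j + m)%N = D j.
    apply: (scalerI sth); rewrite !Dm natrD mulrDl mth sinD2pin.
    by rewrite addrAC sinD2pin.
  pose w := P m - P 0%N.
  have Pper j : P (j + m)%N = P j + w.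
    elim: j => [|j IHj]; first by rewrite /w addrC subrK.
    have := Dper j; rewrite !DE addSn IHj => /eqP.
    by rewrite subr_eq => /eqP ->; rewrite addrA subrK.
  have Pmul l : P (l * m)%N = P 0%N + l%:R *: w.
    elim: l => [|l IHl]; first by rewrite scale0r addr0.
    by rewrite mulSnr Pper IHl -addrA -[in RHS]natr1 scalerDl scale1r.
  have w0 : w = 0.
    have := Pmul d; rewrite mulnC -nE -[n in P n]add0n Pn => /eqP.
    rewrite -subr_eq0 opprD addrA subrr sub0r oppr_eq0 scaler_eq0 pnatr_eq0.
    by rewrite -leqn0 leqNgt d0 /= => /eqP.
  have vm : v m%:R = v 0%:R.
    have := Pper 0%N; rewrite w0 addr0 add0n /P !pE => /eqP.
    by rewrite -subr_eq0 opprB addrA subrK subr_eq0 => /eqP.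
  have m0 : m%:R = 0%:R :> 'Z_n.
    apply/eqP; apply/negPn/negP => /eqP m0.
    by have [] := lobell_inj L m0.
  have : (n %| m)%N.
    by move/(congr1 val): m0; rewrite /= val_Zp_nat // => mn0; apply/eqP.
  have m_gt0 : (0 < m)%N by rewrite divn_gt0 // dvdn_leq ?dvdn_gcdr // ltnW.
  move=> /(dvdn_leq m_gt0); rewrite {1}nE.
  rewrite -{2}(muln1 m) leq_pmul2l // => d1.
  by rewrite /coprime -/d eqn_leq d1.
rewrite -cth; congr cos; apply: (mulfI n0); rewrite nth.
by field.
Qed.

End Angle.

(** * Algebraic numbers of bounded degree *)

Section RationalPolynomials.
Variable F : numFieldType.

Definition qeval (P : {poly rat}) (x : F) : F := (map_poly ratr P).[x].

Lemma qevalD P Q x : qeval (P + Q) x = qeval P x + qeval Q x.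
Proof. by rewrite /qeval rmorphD hornerD. Qed.

Lemma qevalB P Q x : qeval (P - Q) x = qeval P x - qeval Q x.
Proof. by rewrite /qeval rmorphB hornerD hornerN. Qed.

Lemma qevalM P Q x : qeval (P * Q) x = qeval P x * qeval Q x.
Proof. by rewrite /qeval rmorphM hornerM. Qed.

Lemma qevalC a x : qeval a%:P x = ratr a.
Proof. by rewrite /qeval map_polyC hornerC. Qed.

Lemma qeval0 x : qeval 0 x = 0.
Proof. by rewrite -polyC0 qevalC rmorph0. Qed.

Lemma qeval1 x : qeval 1 x = 1.
Proof. by rewrite -polyC1 qevalC rmorph1. Qed.

Lemma qevalX x : qeval 'X x = x.
Proof. by rewrite /qeval map_polyX hornerX. Qed.

Lemma qeval_nat n x : qeval n%:R x = n%:R.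
Proof. by rewrite /qeval !rmorph_nat -polyC_natr hornerC. Qed.

Lemma qevalXn P n x : qeval (P ^+ n) x = qeval P x ^+ n.
Proof. by rewrite /qeval rmorphXn horner_exp. Qed.

Lemma qeval_comp P Q x : qeval (P \Po Q) x = qeval P (qeval Q x).
Proof. by rewrite /qeval map_comp_poly horner_comp. Qed.

Definition qevalE := (qevalB, qevalD, qevalM, qeval1, qeval_nat, qevalXn,
  qeval_comp, qevalX).

Definition algebraic_le (d : nat) (x : F) : Prop :=
  exists h : {poly rat}, [/\ h != 0, (size h <= d.+1)%N & qeval h x = 0].

Lemma minimal_annihilator d (c : F) : algebraic_le d c ->
  exists f : {poly rat}, [/\ f != 0, (size f <= d.+1)%N, qeval f c = 0
   & forall P, qeval P c = 0 -> f %| P].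
Proof.
move=> [h [h0 hd hc]].
pose ann n := `[< exists f : {poly rat}, [/\ f != 0, size f = n & qeval f c = 0] >].
have ann_h : ann (size h) by apply/asboolP; exists h.
have ex_ann : exists n, ann n by exists (size h).
have [n /asboolP[f [f0 fn fc]] n_min] := ex_minnP ex_ann.
exists f; split=> //; first by rewrite fn (leq_trans _ hd) // n_min.
move=> P Pc; apply/negPn/negP => Nf.
have r0 : P %% f != 0 by rewrite -/(dvdp f P).
have : (n <= size (P %% f)%R)%N.
  apply: n_min; apply/asboolP; exists (P %% f); split=> //.
  by move: Pc; rewrite {1}(divp_eq P f) qevalD qevalM fc mulr0 add0r.
by rewrite leqNgt -fn ltn_modp f0.
Qed.

(** The quotient of P(c) by Q(c) is again a value: if Q(c) is not 0, then Q is
    prime to the minimal annihilator f of c, and a Bezout relation inverts Q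
    modulo f. *)
Lemma algebraic_values_closed d (c : F) : algebraic_le d c ->
  divring_closed (fun x : F => x \in [set qeval P c | P in [set: {poly rat}]]).
Proof.
move=> /minimal_annihilator[f [f0 fd fc fmin]].
split=> [|x y|x y]; rewrite /in_mem /= !inE.
- by exists 1; rewrite ?qeval1.
- by move=> [P _ <-] [Q _ <-]; exists (P - Q); rewrite ?qevalB.
move=> [P _ <-] [Q _ <-].
have [Q0|Q0] := eqVneq (qeval Q c) 0.
  by exists 0; rewrite // qeval0 Q0 invr0 mulr0.
(* gcd(f, Q) does not vanish at c, so f divides its cofactor. *)
have cop : coprimep f Q.
  have gf := dvdp_gcdl f Q; have gQ := dvdp_gcdr f Q.
  have [e fE] := dvdpP _ _ gf.
  have gc0 : qeval (gcdp f Q) c != 0.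
    apply: contraNneq Q0 => gc0.
    by have [e' ->] := dvdpP _ _ gQ; rewrite qevalM gc0 mulr0.
  have ec0 : qeval e c = 0.
    by move: fc; rewrite fE qevalM => /eqP; rewrite mulf_eq0 (negbTE gc0) orbF => /eqP.
  have fe := fmin _ ec0.
  have e0 : e != 0 by apply: contraNneq f0 => e0; rewrite fE e0 mul0r.
  have g0 : gcdp f Q != 0 by rewrite gcdp_eq0 negb_and f0.
  have : (size (e * gcdp f Q)%R <= size e)%N by rewrite -fE dvdp_leq.
  rewrite size_mul //.
  rewrite /coprimep; move: (size_poly_gt0 e) (size_poly_gt0 (gcdp f Q)).
  rewrite e0 g0 => e_gt0 g_gt0; move: e_gt0 g_gt0.
  case: (size e) => // a _; case: (size (gcdp f Q)) => [//|[//|k]] _.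
  by rewrite addSn addnS /= ltnNge; rewrite addnS leq_addr.
have [[a b] /= ab] := Bezout_eq1_coprimepP _ _ cop.
exists (P * b) => //; rewrite qevalM; congr (_ * _).
apply: (mulIf Q0); rewrite mulVf // -qevalM.
have := congr1 (qeval ^~ c) ab.
by rewrite /= qevalD !qevalM fc mulr0 add0r qeval1.
Qed.

(** If f has degree k, then the k + 1 remainders of 1, P, ..., P^k modulo f are
    linearly dependent. *)
Lemma algebraic_value d (c : F) (P : {poly rat}) : algebraic_le d c ->
  algebraic_le d (qeval P c).
Proof.
move=> /minimal_annihilator[f [f0 fd fc fmin]].
have [k fk] : exists k, size f = k.+1.
  by exists (size f).-1; rewrite prednK // size_poly_gt0.
have kd : (k <= d)%N by rewrite fk in fd.
pose M : 'M[rat]_(k.+1, k) := \matrix_(i < k.+1) poly_rV (P ^+ i %% f).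
have : kermx M != 0.
  rewrite kermx_eq0 /row_free; apply: contraTneq (rank_leq_col M) => ->.
  by rewrite ltnn.
move=> /rowV0Pn[a /sub_kermxP aM a0].
exists (rVpoly a); split.
- apply: contraNneq a0 => a0.
  by rewrite -(rVpolyK a) a0 linear0.
- by rewrite (leq_trans (size_poly _ _)).
have hE : qeval (rVpoly a) (qeval P c) = qeval (\sum_(i < k.+1) a 0 i *: P ^+ i) c.
  rewrite -qeval_comp; congr (qeval _ _).
  rewrite /rVpoly poly_def raddf_sum /=; apply: eq_bigr => i _.
  by rewrite valK comp_polyZ rmorphXn /= comp_polyX.
rewrite hE; set S := \sum_(i < _) _.
have Sf : S %% f = 0.
  have modp_sum m (G : 'I_m -> {poly rat}) :
      (\sum_i G i) %% f = \sum_i (G i %% f).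
    exact: (big_morph (fun q => q %% f) (modpD f) (mod0p f)).
  have : rVpoly (a *m M) = 0 by rewrite aM linear0.
  move=> <-; rewrite mulmx_sum_row linear_sum /= /S modp_sum.
  apply: eq_bigr => i _; rewrite modpZl linearZ /= rowK poly_rV_K //.
  by have := ltn_modp (P ^+ i) f; rewrite f0 fk ltnS.
by rewrite (divp_eq S f) Sf addr0 qevalM fc mulr0.
Qed.

End RationalPolynomials.

(** * Chebyshev polynomials and traces of powers *)

Section Chebyshev.
Variable R : realType.
Local Notation qeval := (@qeval R).

Fixpoint chebyshev (m : nat) : {poly rat} :=
  if m is m1.+1 then
    if m1 is m2.+1 then 2%:R * 'X * chebyshev m1 - chebyshev m2 else 'X
  else 1.

Lemma chebyshevSS m : chebyshev m.+2 = 2%:R * 'X * chebyshev m.+1 - chebyshev m.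
Proof. by []. Qed.

Lemma size_chebyshev m : (size (chebyshev m) <= m.+1)%N.
Proof.
elim/nat_ind2: m => [||m IH1 IH2]; rewrite ?size_poly1 ?size_polyX //.
rewrite chebyshevSS (leq_trans (size_polyD _ _)) // size_polyN geq_max.
apply/andP; split; last exact: leq_trans IH1 (leqW (leqnSn _)).
have -> : 2%:R * 'X * chebyshev m.+1 = (2%:R *: chebyshev m.+1) * 'X :> {poly rat}.
  by rewrite -mul_polyC polyC_natr mulrAC.
rewrite (leq_trans (size_polyMleq _ _)) // size_polyX addn2 /= ltnS.
exact: leq_trans (size_scale_leq _ _) IH2.
Qed.

Lemma qeval_chebyshevSS m x :
  qeval (chebyshev m.+2) x = 2 * x * qeval (chebyshev m.+1) x - qeval (chebyshev m) x.
Proof. by rewrite chebyshevSS !qevalE. Qed.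

Lemma qeval_chebyshev_cos m (x : R) : qeval (chebyshev m) (cos x) = cos (m%:R * x).
Proof.
elim/nat_ind2: m => [||m IH1 IH2].
- by rewrite qeval1 mul0r cos0.
- by rewrite qevalX mul1r.
- by rewrite qeval_chebyshevSS IH1 IH2 cos_recurrence.
Qed.

Lemma qeval_chebyshev1 m : qeval (chebyshev m) 1 = 1.
Proof. by rewrite -{1}(cos0 R) qeval_chebyshev_cos mulr0 cos0. Qed.

Lemma qeval_chebyshevN1 m : qeval (chebyshev m) (-1) = (-1) ^+ m.
Proof.
elim/nat_ind2: m => [||m IH1 IH2]; [exact: qeval1|exact: qevalX|].
by rewrite qeval_chebyshevSS IH1 IH2 !exprS; ring.
Qed.

(** The increments T_(m+1) - T_m are nonnegative and nondecreasing on [1, +oo),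
    since T_(m+2) - T_(m+1) = (2 X - 2) T_(m+1) + (T_(m+1) - T_m). *)
Lemma chebyshev_increasing (x y : R) m : 1 <= y -> y < x -> (0 < m)%N ->
  1 <= qeval (chebyshev m) y < qeval (chebyshev m) x.
Proof.
move=> y1 yx; have x1 : 1 < x by exact: le_lt_trans yx.
case: m => // m _; move: m.
pose d z m := qeval (chebyshev m.+1) z - qeval (chebyshev m) z.
have dS z m : d z m.+1 = (2 * z - 2) * qeval (chebyshev m.+1) z + d z m.
  by rewrite /d qeval_chebyshevSS; ring.
have cS z m : qeval (chebyshev m.+2) z = qeval (chebyshev m.+1) z + d z m.+1.
  by rewrite /d addrC subrK.
suff H m : [/\ 1 <= qeval (chebyshev m.+1) y, qeval (chebyshev m.+1) y < qeval (chebyshev m.+1) x,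
    0 <= d y m & d y m <= d x m] by move=> m; case: (H m) => -> ->.
elim: m => [|m [IH1 IH2 IH3 IH4]].
  by rewrite /d !qevalE; split => //; lra.
have d1 : 0 <= d y m.+1 by rewrite dS addr_ge0 // mulr_ge0 //; lra.
have d2 : d y m.+1 <= d x m.+1.
  rewrite !dS; apply: lerD => //; apply: ler_pM => //; lra.
by rewrite !cS; split => //; lra.
Qed.

(** T_m is increasing from 1 on, and at most 1 on [-1, 1]. *)
Lemma chebyshev_inj (x y : R) m : 1 < x -> -1 <= y -> (0 < m)%N ->
  qeval (chebyshev m) x = qeval (chebyshev m) y -> x = y.
Proof.
move=> x1 y1 m0 xy; have [y_le1|y_gt1] := leP y 1.
  have /andP[_] := chebyshev_increasing (lexx 1) x1 m0.
  rewrite qeval_chebyshev1 xy -(@acosK R y) ?in_itv /= ?y1 // qeval_chebyshev_cos.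
  by rewrite ltNge cos_le1.
have [xy'|yx|//] := ltgtP x y.
  have /andP[_] := chebyshev_increasing (ltW x1) xy' m0.
  by rewrite xy ltxx.
have /andP[_] := chebyshev_increasing (ltW y_gt1) yx m0.
by rewrite xy ltxx.
Qed.

(** 2 + 2 T_m(x) with x = 2 (1 + 2 X)^2 - 1: at X = c this is the trace of the m-th
    power of a product of reflections in unit vectors of product 1 + 2 c or
    - (1 + 2 c). *)
Definition power_trace (m : nat) : {poly rat} :=
  2%:R + 2%:R * (chebyshev m \Po (2%:R * (1 + 2%:R * 'X) ^+ 2 - 1)).

Lemma power_traceE m c : qeval (power_trace m) c
  = 2 + 2 * qeval (chebyshev m) (2 * (1 + 2 * c) ^+ 2 - 1).
Proof. by rewrite /power_trace !qevalE. Qed.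

(** (1 + 2 x)^2 takes its value at c again at - 1 - c only, which is < - 1. *)
Lemma power_trace_inj (c c' : R) m : 0 < c -> -1 <= c' <= 1 -> (0 < m)%N ->
  qeval (power_trace m) c = qeval (power_trace m) c' -> c = c'.
Proof.
move=> c0 /andP[c'1 c'2] m0; rewrite !power_traceE => E.
have {}E : qeval (chebyshev m) (2 * (1 + 2 * c) ^+ 2 - 1)
    = qeval (chebyshev m) (2 * (1 + 2 * c') ^+ 2 - 1) by lra.
have := chebyshev_inj _ _ m0 E.
have -> : 1 < 2 * (1 + 2 * c) ^+ 2 - 1 by nra.
have -> : -1 <= 2 * (1 + 2 * c') ^+ 2 - 1.
  by have := sqr_ge0 (1 + 2 * c'); lra.
move=> /(_ isT isT) sq.
have : (c - c') * (1 + c + c') = 0 by lra.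
move=> /eqP; rewrite mulf_eq0 subr_eq0 => /orP[/eqP //|/eqP]; lra.
Qed.

End Chebyshev.

(** * Conjugates of cos (2 pi / p) *)

Section Cyclotomic.

Definition unity_sum p : {poly rat} := \poly_(i < p) 1.

Lemma unity_sumE p : ('X - 1) * unity_sum p = 'X^p - 1.
Proof.
rewrite subrX1 /unity_sum poly_def; congr (_ * _).
by apply: eq_bigr => i _; rewrite scale1r.
Qed.

Lemma size_unity_sum p : (0 < p)%N -> size (unity_sum p) = p.
Proof. by case: p => // p _; rewrite size_poly_eq // oner_eq0. Qed.

Lemma unity_sum_root (F : fieldType) (iota : {rmorphism rat -> F}) p (z : F) :
  z ^+ p = 1 -> z != 1 -> (map_poly iota (unity_sum p)).[z] = 0.
Proof.
move=> zp z1.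
have := congr1 (fun P => (map_poly iota P).[z]) (unity_sumE p).
rewrite rmorphM !rmorphB /= rmorph1 map_polyX map_polyXn hornerM !hornerE.
by rewrite zp subrr => /eqP; rewrite mulf_eq0 subr_eq0 (negbTE z1) => /eqP.
Qed.

Lemma prime_unity_root p (w : algC) : prime p -> w ^+ p = 1 -> w != 1 ->
  p.-primitive_root w.
Proof.
move=> pp wp w1; have [m prim_w mp] := prim_order_exists (prime_gt0 pp) wp.
have /orP[/eqP m1|/eqP <- //] : (m == 1)%N || (m == p).
  by case/primeP: pp => _; apply.
case/eqP: w1; have := prim_expr_order prim_w.
by rewrite m1 expr1.
Qed.

(** For p prime, 1 + X + ... + X^(p-1) is irreducible over Q, so it divides any
    rational polynomial with which it has a common root in some field. A common
    divisor of the two has a root among the complex algebraic numbers, which is a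
    primitive p-th root of unity, and its minimal polynomial is cyclotomic. *)
Lemma unity_sum_dvd (F : fieldType) (iota : {rmorphism rat -> F}) p (z : F)
    (Q : {poly rat}) : prime p -> z ^+ p = 1 -> z != 1 ->
  (map_poly iota Q).[z] = 0 -> unity_sum p %| Q.
Proof.
move=> pp zp z1 Qz; have p0 := prime_gt0 pp.
set Phi := unity_sum p; have Phi_z := unity_sum_root iota zp z1.
have Phi0 : Phi != 0 by rewrite -size_poly_gt0 size_unity_sum.
pose G := gcdp Q Phi.
have GPhi : G %| Phi := dvdp_gcdr _ _.
have sizeG : size G != 1.
  apply/negP => /Bezout_eq1_coprimepP[[a b] /= ab].
  have := congr1 (fun P => (map_poly iota P).[z]) ab.
  rewrite rmorphD !rmorphM /= rmorph1 hornerD !hornerM Qz Phi_z !mulr0 addr0.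
  by rewrite hornerC => /esym/eqP; rewrite oner_eq0.
pose toC := map_poly (ratr : rat -> algC).
have [w Gw] : exists w, root (toC G) w.
  by apply/closed_rootP; rewrite size_map_poly.
have Phi_w : root (toC Phi) w.
  by rewrite (root_dvdp _ Gw) // /toC dvdp_map.
have wE := congr1 (fun P => (toC P).[w]) (unity_sumE p).
have wp : w ^+ p = 1.
  move: wE; rewrite /toC rmorphM !rmorphB /= rmorph1 map_polyX map_polyXn.
  rewrite hornerM (eqP Phi_w) mulr0 !hornerE => /esym/eqP.
  by rewrite subr_eq0 => /eqP.
have w1 : w != 1.
  apply: contraTneq Phi_w => ->; rewrite /root /toC /Phi /unity_sum.
  rewrite poly_def rmorph_sum /= horner_sum.
  under eq_bigr => i _ do rewrite scale1r map_polyXn hornerXn expr1n.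
  by rewrite sumr_const card_ord pnatr_eq0 -lt0n.
have prim_w := prime_unity_root pp wp w1.
have [m [mE _] m_dvd] := minCpolyP w.
have size_m : size m = p.
  rewrite -(size_map_poly (ratr : {rmorphism rat -> algC})) /= -mE.
  by rewrite (minCpoly_cyclotomic prim_w) size_cyclotomic totient_prime ?prednK.
have mPhi : m %| Phi by rewrite -m_dvd.
have mG : m %| G by rewrite -m_dvd.
have : m %= Phi by rewrite -(dvdp_size_eqp mPhi) size_m size_unity_sum.
by move=> /eqp_dvdl <-; apply: dvdp_trans mG (dvdp_gcdl _ _).
Qed.

End Cyclotomic.

Section Conjugates.
Import complex.
Variable R : realType.
Local Notation qeval := (@qeval R).
Local Notation C := (complex R).

Definition zeta (x : R) : C := Complex (cos x) (sin x).

Lemma zetaD x y : zeta (x + y) = zeta x * zeta y.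
Proof. by rewrite /zeta cosD sinD; congr Complex; rewrite addrC. Qed.

Lemma zeta0 : zeta 0 = 1.
Proof. by rewrite /zeta cos0 sin0. Qed.

Lemma zetaX x m : zeta x ^+ m = zeta (m%:R * x).
Proof.
elim: m => [|m IHm]; first by rewrite mul0r zeta0.
by rewrite exprS IHm -zetaD -natr1 mulrDl mul1r addrC.
Qed.

Lemma zeta_sqr x : zeta x ^+ 2 + 1 = real_complex R (2 * cos x) * zeta x.
Proof.
have -> : real_complex R (2 * cos x) = zeta x + zeta (- x).
  by rewrite /zeta cosN sinN; apply/eqP; rewrite eq_complex /= subrr
    mulr_natl mulr2n !eqxx.
by rewrite mulrDl -expr2 -zetaD addNr zeta0.
Qed.

Let iota : rat -> C := real_complex R \o ratr.

(** The numerator of P((X + 1/X) / 2), which turns a relation satisfied by cos x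
    into one satisfied by exp(i x). *)
Definition joukowski (P : {poly rat}) : {poly rat} :=
  \sum_(l < size P) (P`_l / 2%:R ^+ l) *: (('X^2 + 1) ^+ l * 'X^(size P - l)).

Lemma joukowskiE P x : (map_poly iota (joukowski P)).[zeta x]
  = zeta x ^+ size P * real_complex R (qeval P (cos x)).
Proof.
rewrite /joukowski rmorph_sum horner_sum /qeval horner_coef size_map_poly.
rewrite rmorph_sum mulr_sumr; apply: eq_bigr => l _.
have mapE k : map_poly iota (('X^2 + 1) ^+ l * 'X^k) = ('X^2 + 1) ^+ l * 'X^k.
  by rewrite rmorphM rmorphXn rmorphD /= rmorph1 !map_polyXn.
rewrite /= map_polyZ mapE !hornerE zeta_sqr exprMn.
have -> : zeta x ^+ size P = zeta x ^+ l * zeta x ^+ (size P - l).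
  by rewrite -exprD subnKC // ltnW.
have iotaE : iota (P`_l / 2 ^+ l) = iota P`_l / 2 ^+ l.
  have ratrE : ratr (P`_l / 2 ^+ l) = ratr P`_l / 2 ^+ l :> R.
    by rewrite fmorph_div rmorphXn /= ratr_nat.
  by rewrite /iota /= ratrE fmorph_div rmorphXn /= rmorph_nat.
rewrite /= -!mulrA [X in X * _ = _]iotaE.
have -> : real_complex R (2 * cos x) = 2 * real_complex R (cos x).
  by rewrite rmorphM rmorph_nat.
have -> : real_complex R ((map_poly ratr P)`_l * cos x ^+ l)
    = iota P`_l * real_complex R (cos x) ^+ l.
  by rewrite coef_map rmorphM rmorphXn.
have two0 : (2 : C) != 0 by rewrite pnatr_eq0.
by rewrite exprMn; field.
Qed.

Lemma zeta_prime_root p i : prime p -> ~~ (p %| i)%N ->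
  zeta (i%:R * (2 * pi / p%:R)) ^+ p = 1 /\ zeta (i%:R * (2 * pi / p%:R)) != 1.
Proof.
move=> pp pi_; have p0 : p%:R != 0 :> R by rewrite pnatr_eq0 -lt0n prime_gt0.
split.
  rewrite zetaX; have -> : p%:R * (i%:R * (2 * pi / p%:R)) = 0 + i%:R * (2 * pi) :> R.
    by field.
  by rewrite /zeta cosD2pin sinD2pin cos0 sin0.
apply: contra pi_ => /eqP[c1 _].
have [|k kE] := cos_eq1 _ c1.
  by rewrite mulr_ge0 ?divr_ge0 ?mulr_ge0 ?pi_ge0.
have : i%:R = (k * p)%:R :> R.
  have pi0 : 2 * pi != 0 :> R by rewrite mulf_neq0 ?pnatr_eq0 // gt_eqF ?pi_gt0.
  by apply: (mulIf pi0); rewrite natrM mulrAC -kE; field.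
by move=> /eqP; rewrite eqr_nat => /eqP ->; apply: dvdn_mull.
Qed.

(** The corresponding p-th roots of unity are roots of the same rational
    polynomials, since 1 + X + ... + X^(p-1) is irreducible. *)
Lemma cos_conjugate p i j (P : {poly rat}) :
    prime p -> ~~ (p %| i)%N -> ~~ (p %| j)%N ->
  qeval P (cos (i%:R * (2 * pi / p%:R))) = 0 ->
  qeval P (cos (j%:R * (2 * pi / p%:R))) = 0.
Proof.
move=> pp pNi pNj Pi0.
have [zp z1] := zeta_prime_root pp pNi; have [zp' z1'] := zeta_prime_root pp pNj.
have /(unity_sum_dvd pp zp z1)/dvdpP[Q QE] :
    (map_poly iota (joukowski P)).[zeta (i%:R * (2 * pi / p%:R))] = 0.
  by rewrite joukowskiE Pi0 rmorph0 mulr0.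
have : (map_poly iota (joukowski P)).[zeta (j%:R * (2 * pi / p%:R))] = 0.
  by rewrite QE rmorphM hornerM unity_sum_root ?mulr0.
rewrite joukowskiE => /eqP; rewrite mulf_eq0 expf_eq0 => /orP[/andP[_ /eqP z0]|].
  by move: zp'; rewrite z0 expr0n gtn_eqF ?prime_gt0 // => /esym/eqP; rewrite oner_eq0.
by move=> /eqP[].
Qed.

End Conjugates.

Section Degree.
Variable R : realType.
Local Notation qeval := (@qeval R).
Local Notation turn p := (2 * pi / p%:R : R).

Lemma cosnM p (k l : nat) :
  cos ((l * k)%:R * turn p) = qeval (chebyshev l) (cos (k%:R * turn p)).
Proof. by rewrite qeval_chebyshev_cos natrM -[in LHS]mulrA. Qed.

Lemma cos_turn_inj p i j : (0 < i <= p.-1./2)%N -> (0 < j <= p.-1./2)%N ->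
  cos (i%:R * turn p) = cos (j%:R * turn p) -> i = j.
Proof.
move=> ip jp; have half k : (0 < k <= p.-1./2)%N -> (k * 2 < p)%N.
  by rewrite geq_half_double -muln2 => /andP[k0]; case: (p) => [|p'] /=; lia.
have p0 : 0 < p%:R :> R by rewrite ltr0n; have := half _ ip; lia.
have in_pi k : (0 < k <= p.-1./2)%N -> k%:R * turn p \in `[0, pi].
  move=> kp; rewrite in_itv /= mulr_ge0 ?divr_ge0 ?mulr_ge0 ?pi_ge0 //=.
  rewrite !mulrA ler_pdivrMr // [leRHS]mulrC ler_pM2r ?pi_gt0 //.
  by rewrite -natrM ler_nat ltnW // half.
move=> /cos_inj E; have := E (in_pi _ ip) (in_pi _ jp).
have t0 : turn p != 0.
  by rewrite mulf_neq0 ?invr_eq0 ?gt_eqF // mulr_gt0 ?pi_gt0.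
by move=> /(mulIf t0)/eqP; rewrite eqr_nat => /eqP.
Qed.

(** All the values of power_trace m at the conjugates of c = cos (2 pi k / p) are
    roots of h. They are pairwise distinct: an equality between two of them can
    be conjugated into one between the value at c and another one, which
    power_trace_inj excludes. *)
Lemma power_trace_degree p k m (h : {poly rat}) :
    prime p -> (2 < p)%N -> ~~ (p %| k)%N -> 0 < cos (k%:R * turn p) -> (0 < m)%N ->
    h != 0 -> qeval h (qeval (power_trace m) (cos (k%:R * turn p))) = 0 ->
  (p.-1./2 < size h)%N.
Proof.
move=> pp p2 pNk ck0 m0 h0 hk.
pose tr j := qeval (power_trace m) (cos (j%:R * turn p)).
pose rs := [seq tr j | j <- iota 1 p.-1./2].
have rsP j : j \in iota 1 p.-1./2 -> (0 < j <= p.-1./2)%N.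
  by rewrite mem_iota add1n ltnS.
have small j : (0 < j <= p.-1./2)%N -> ~~ (p %| j)%N.
  rewrite geq_half_double -muln2 => /andP[j0 jp].
  by apply/negP => /(dvdn_leq j0); move: jp; case: (p) => [|p'] /=; lia.
have tr_inj : {in iota 1 p.-1./2 &, injective tr}.
  move=> i j /rsP iP /rsP jP ij.
  have pNi := small _ iP; have i0 : (0 < i)%N by case/andP: iP.
  have cop : gcdn i p = 1%N.
    by apply/eqP; rewrite -/(coprime _ _) coprime_sym prime_coprime.
  have [a b ab _] := egcdnP p i0; rewrite cop in ab.
  pose l := (k * a)%N.
  have liE : (l * i)%:R * turn p = k%:R * turn p + (k * b)%:R * (2 * pi) :> R.
    rewrite /l -mulnA ab mulnDr muln1 natrD mulnA natrM mulrDl addrC; congr (_ + _).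
    have pn0 : p%:R != 0 :> R by rewrite pnatr_eq0 -lt0n prime_gt0.
    by field.
  have pNl : ~~ (p %| l)%N.
    apply: contra pNk => pl.
    have : (p %| l * i)%N by rewrite dvdn_mulr.
    rewrite /l -mulnA ab mulnDr muln1 mulnA dvdn_addr //.
    exact: dvdn_mull.
  have cli : cos ((i * l)%:R * turn p) = cos (k%:R * turn p).
    by rewrite mulnC liE cosD2pin.
  (* Conjugate the equality so that i becomes i l = k modulo p. *)
  have trl : tr (i * l)%N = tr (j * l)%N.
    have : qeval ((power_trace m \Po chebyshev i) - (power_trace m \Po chebyshev j))
              (cos (1%:R * turn p)) = 0.
      rewrite qevalB !qeval_comp -!cosnM !muln1.
      by apply/eqP; rewrite subr_eq0; apply/eqP.
    move=> /(cos_conjugate pp _ pNl); rewrite dvdn1 gtn_eqF ?prime_gt1 //.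
    move=> /(_ isT)/eqP; rewrite qevalB !qeval_comp -!cosnM subr_eq0.
    by move=> /eqP.
  have clj : cos (k%:R * turn p) = cos ((j * l)%:R * turn p).
    apply: (power_trace_inj ck0 _ m0); first by rewrite cos_geN1 cos_le1.
    by rewrite -cli.
  have : qeval (chebyshev i - chebyshev j) (cos (l%:R * turn p)) = 0.
    by rewrite qevalB -!cosnM cli clj subrr.
  move=> /(@cos_conjugate _ p _ 1 _ pp pNl); rewrite dvdn1 gtn_eqF ?prime_gt1 //.
  move=> /(_ isT)/eqP; rewrite qevalB -!cosnM !muln1 subr_eq0 => /eqP.
  exact: cos_turn_inj.
have uniq_rs : uniq rs by rewrite map_inj_in_uniq // iota_uniq.
have root_rs : all (root (map_poly (ratr : rat -> R) h)) rs.
  apply/allP => _ /mapP[j /rsP/small pNj ->]; apply/eqP.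
  have := @cos_conjugate R p k j (h \Po power_trace m) pp pNk pNj.
  by rewrite !qeval_comp; apply.
have := max_poly_roots _ root_rs uniq_rs.
by rewrite map_poly_eq0 size_map_poly size_map size_iota; apply.
Qed.

(** For q = 2 r + 1, the angle x = 2 pi / q satisfies cos ((r + 1) x) = cos (r x),
    so cos x is a root of T_(r+1) - T_r, which also has the root 1; dividing by
    X - 1 leaves the degree r = (q - 1) / 2. *)
Lemma cos_turn_algebraic q : prime q -> (2 < q)%N ->
  algebraic_le q.-1./2 (cos (turn q)).
Proof.
move=> qq q2; set r := q.-1./2.
have qE : q = r.*2.+1.
  have := even_prime qq; rewrite /r; case: (q) q2 => [//|q'] q'2 [|/=]; lia.
have q0 : q%:R != 0 :> R by rewrite pnatr_eq0 -lt0n prime_gt0.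
pose P := chebyshev r.+1 - chebyshev r.
have qevalP x : qeval P x = qeval (chebyshev r.+1) x - qeval (chebyshev r) x.
  by rewrite qevalB.
have root1 : root P 1.
  apply/eqP/(fmorph_inj (ratr : {rmorphism rat -> R})) => /=.
  by rewrite -horner_map /= rmorph1 rmorph0 -/(qeval P 1) qevalP !qeval_chebyshev1 subrr.
(* P takes the value 2 or - 2 at - 1. *)
have P0 : P != 0.
  apply/eqP => P0; have := qevalP (-1).
  rewrite P0 qeval0 !qeval_chebyshevN1 exprS mulN1r => /esym/eqP.
  by rewrite -opprD oppr_eq0 -mulr2n mulrn_eq0 /= signr_eq0.
have [f fE] := factor_theorem _ _ root1.
have f0 : f != 0 by apply: contraNneq P0 => f0; rewrite fE f0 mul0r.
exists f; split=> //.
  have : (size P <= r.+2)%N.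
    rewrite (leq_trans (size_polyD _ _)) // size_polyN geq_max size_chebyshev.
    exact: leq_trans (size_chebyshev _) (leqnSn _).
  rewrite fE size_mul ?polyXsubC_eq0 // size_XsubC addn2 /=.
  by rewrite ltnS.
have pi0 : 0 < 2 * pi :> R by rewrite mulr_gt0 ?pi_gt0.
have c1 : cos (turn q) != 1.
  apply/eqP => /cos_eq1[|k kE]; first by rewrite divr_ge0 ?ler0n // ltW.
  have : 1 = (k * q)%:R :> R.
    apply: (mulIf (lt0r_neq0 pi0)); rewrite natrM mulrAC -kE; field.
    exact: q0.
  move/eqP; rewrite eq_sym pnatr_eq1 muln_eq1 => /andP[_ /eqP q1].
  by rewrite q1 in q2.
have := qevalP (cos (turn q)).
have -> : qeval (chebyshev r.+1) (cos (turn q)) = qeval (chebyshev r) (cos (turn q)).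
  rewrite !qeval_chebyshev_cos.
  have -> : r.+1%:R * turn q = - (r%:R * turn q) + 1%:R * (2 * pi).
    apply: (mulfI q0); rewrite -natr1.
    have -> : q%:R * ((r%:R + 1) * turn q) = (r%:R + 1) * (2 * pi) by field.
    have -> : q%:R * (- (r%:R * turn q) + 1%:R * (2 * pi))
        = - (r%:R * (2 * pi)) + q%:R * (2 * pi) by field.
    have -> : q%:R = r%:R + r%:R + 1 :> R by rewrite {1}qE -addnn -natr1 natrD.
    by ring.
  by rewrite cosD2pin cosN.
rewrite subrr fE qevalM qevalB qevalX qevalC rmorph1 => /eqP.
by rewrite mulf_eq0 subr_eq0 (negbTE c1) orbF => /eqP.
Qed.
End Degree.

(** * Subfields generated by real numbers *)

Section Qadjoin.
Variable R : realType.
Implicit Types (S : set R) (K : divringClosed R).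

Lemma Qadjoin_closed S : divring_closed (mem (Qadjoin S)).
Proof.
split=> [|x y|x y]; rewrite ?inE.
- by move=> K [[K1 _ _] _]; rewrite inE in K1.
- move=> xS yS K KS; case: (KS) => -[_ KB _] _.
  have := KB x y; rewrite !inE; apply; [exact: xS|exact: yS].
- move=> xS yS K KS; case: (KS) => -[_ _ KV] _.
  have := KV x y; rewrite !inE; apply; [exact: xS|exact: yS].
Qed.

(** Qadjoin S as a boolean predicate, which can carry the structure of a
    predicate closed under field operations. *)
Definition Qfield S : {pred R} := fun x => x \in Qadjoin S.

HB.instance Definition _ S :=
  GRing.isDivringClosed.Build R (Qfield S) (Qadjoin_closed S).

Lemma QfieldP S x : reflect (Qadjoin S x) (x \in Qfield S).
Proof. by rewrite unfold_in; apply: (iffP idP); rewrite inE. Qed.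

Lemma Qadjoin_sub S K : {in S, forall x, x \in K} ->
  Qadjoin S `<=` [set x | x \in K].
Proof.
move=> SK; apply: smallest_sub => [|x Sx]; last by apply: SK; rewrite inE.
have [K1 KB KV] := divringClosedP K.
by split=> [|x y|x y]; rewrite !inE //=; [exact: KB|exact: KV].
Qed.

Lemma Qfield_gen S x : S x -> x \in Qfield S.
Proof. by move=> Sx; apply/QfieldP; apply: sub_gen_smallest. Qed.

Lemma chebyshev_closed K x m : x \in K -> qeval (chebyshev m) x \in K.
Proof.
move=> xK; elim/nat_ind2: m => [||m IH1 IH2].
- by rewrite qeval1 rpred1.
- by rewrite qevalX.
- by rewrite qeval_chebyshevSS rpredB // !rpredM // rpred_nat.
Qed.

Local Notation turn n := (2%:R * pi / n%:R : R).

(** If a k = 1 + b n, then cos (2 pi / n) = T_a (cos (2 pi k / n)). *)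
Lemma cos_coprime_closed n k K : (0 < n)%N -> coprime k n ->
  cos (k%:R * turn n) \in K -> cos (turn n) \in K.
Proof.
move=> n0 kn ckK; have [k0|k0] := posnP k.
  move: kn ckK; rewrite k0 /coprime gcd0n => /eqP n1.
  move=> _; rewrite n1 divr1 -[X in cos X]add0r -[2 * pi]mul1r -[1]/(1%:R).
  by rewrite cosD2pin cos0 rpred1.
have [a b ab _] := egcdnP n k0; rewrite (eqP kn) in ab.
have -> : cos (turn n) = cos ((a * k)%:R * turn n).
  have nn0 : n%:R != 0 :> R by rewrite pnatr_eq0 -lt0n.
  have -> : (a * k)%:R * turn n = turn n + b%:R * (2 * pi) :> R.
    by rewrite ab natrD natrM; field.
  by rewrite cosD2pin.
by rewrite cosnM chebyshev_closed.
Qed.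

End Qadjoin.

(** * Löbell polyhedra *)

Section LobellPolyhedron.
Variables (R : realType) (n : nat) (e : lobell_face n -> 'cV[R]_4).
Hypothesis n5 : (5 <= n)%N.
Hypothesis Le : is_lobell_polyhedron e.
Local Notation "<< x , y >>" := (lform x y).

Lemma acos_pihalf (x : R) : acos x = pi / 2 -> x = 0.
Proof.
have [x1|x1] := boolP (-1 <= x <= 1).
  by move=> xE; rewrite -(@acosK R x) ?in_itv //= xE cos_pihalf.
(* Outside [-1, 1] the value of acos is the default 0. *)
rewrite unlock /acos xgetPN => [/esym/eqP|y [/andP[y0 ypi] yx]]; last first.
  by move/negP: x1; apply; rewrite -yx cos_geN1 cos_le1.
by rewrite gt_eqF // divr_gt0 ?pi_gt0.
Qed.

Lemma lobell_unit F : <<e F, e F>> = 1.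
Proof. by case: Le => -[]. Qed.

Lemma lobell_orthogonal F G : lobell_adj F G -> <<e F, e G>> = 0.
Proof.
case: Le => _ _ adjP right /adjP/right/acos_pihalf/eqP.
by rewrite oppr_eq0 => /eqP.
Qed.

(** A face has a point on no other face, whereas opposite or equal normals define
    the same plane. *)
Lemma lobell_distinct F G : F <> G -> e F <> e G /\ e F <> - e G.
Proof.
case: Le => -[_ faceP] _ _ _ FG; have [x [xP xF] xonly] := faceP F.
split=> eFG; apply: FG; apply/esym/xonly; split=> //; move: xF => /=;
  rewrite eFG // lformNl => /eqP; by rewrite oppr_eq0 => /eqP.
Qed.

Lemma lobell_polyhedron_normals : lobell_normals (e (Top n)) (e (Bottom n))
  (fun i => e (Upper i)) (fun i => e (Lower i)).
Proof.
have [[unit orth] dist] := (lobell_unit, lobell_orthogonal, lobell_distinct).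
split=> [||i|i|i|i|i|i|i|i|i|i j ij]; rewrite ?unit //.
- exact: orth.
- exact: orth.
- by apply: orth; left.
- by apply: orth; left.
- by apply: orth; left.
- by apply: orth; right.
- exact: dist.
- by apply: dist => -[].
Qed.

Lemma reflection_sign k (x : 'cV[R]_4) : k ^+ 2 = 1 ->
  reflection (k *: x) = reflection x.
Proof.
move=> /eqP; rewrite sqrf_eq1 => /orP[] /eqP ->; first by rewrite scale1r.
by rewrite scaleN1r reflectionN.
Qed.

(** The properties of the group through which both claims are proved: c bounds
    the field of traces from above, and the two entries of the Gram matrix, which
    are squared to be independent of the signs of normals, bound it from below. *)
Lemma lobell_invariants : exists k (c : R), [/\ coprime k n,
   c = cos (k%:R * (2 * pi / n%:R)) /\ 0 < c < 1,
   forall K : divringClosed R, c \in K -> forall g, reflection_group e g -> \tr g \in K,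
   <<e (Top n), e (Lower 0)>> ^+ 2 = 1 + (2 * c)^-1
 & <<e (Upper 0), e (Upper (0 + 1 + 1))>> ^+ 2 = (1 + 2 * c) ^+ 2].
Proof.
have [A [s [tau [eu [ev [N eu2 ev2]]]]]] := normalization lobell_polyhedron_normals.
set u := fun i : 'Z_n => _ in N; set v := fun i : 'Z_n => _ in N.
have [k [kn cE c01]] := normalized_angle N (ltac:(lia) : (1 < n)%N).
have An0 := normalized_A_neq0 N.
have [p pE] : {p | forall i, p i = v i - tau *: e (Top n)}.
  by exists (fun i => v i - tau *: e (Top n)).
exists k, (2 * A)^-1; split=> //.
- move=> K cK g gG; have KA : A \in K.
    have -> : A = ((2 * A)^-1 * 2)^-1 by field.
    by rewrite rpredV rpredM // rpred_nat.
  have KA1 : A + 1 \in K by rewrite rpredD ?rpred1.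
  have Ks : s ^+ 2 \in K.
    by rewrite (normalized_s N) !rpredM ?rpredD ?rpredM ?rpred_nat ?rpred1.
  have Kt : tau ^+ 2 \in K by rewrite (normalized_tau N).
  have sn0 := normalized_s_neq0 N; have tn0 := normalized_tau_neq0 N.
  have L := normalized_lobell N.
  apply: (rational_trace N pE KA).
  move: g gG; apply: smallest_sub; first exact: rational_isometry_subgroup.
  move=> _ [[||i|i] _ <-].
  + exact: (rational_reflection N pE KA (lobell_tt L) tn0 Kt (rational_t N pE KA)).
  + apply: (rational_reflection N pE KA (lobell_bb L) _ _ (rational_b N pE KA)).
      by rewrite mulf_neq0 ?invr_eq0.
    by rewrite exprMn exprVn rpredM ?rpredV.
  + rewrite -(reflection_sign _ (eu2 i)).
    have [_ _ uK] := rational_pu N pE KA i.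
    exact: (rational_reflection N pE KA (lobell_uu L i) sn0 Ks uK).
  + rewrite -(reflection_sign _ (ev2 i)).
    apply: (rational_reflection N pE KA (lobell_vv L i) (oner_neq0 _)).
      by rewrite expr1n rpred1.
    by rewrite scale1r (rational_v N pE KA).
- have : <<e (Top n), v 0>> ^+ 2 = A + 1.
    by rewrite (normalized_tv N) (normalized_tau N).
  rewrite /v lformZr exprMn ev2 mul1r => ->; by field.
- have := normalized_uu2 N pE 0; rewrite /u lformZl lformZr => E.
  have : (eu 0 * (eu (0 + 1 + 1) * <<e (Upper 0), e (Upper (0 + 1 + 1))>>)) ^+ 2
      = (- (A + 1) / A) ^+ 2 by rewrite E.
  by rewrite !exprMn !eu2 !mul1r => ->; field.
Qed.

End LobellPolyhedron.

(** * Trace fields and incommensurability *)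

Section Traces.
Variable R : realType.
Local Notation turn n := (2%:R * pi / n%:R : R).

Lemma lobell_trace_field n (e : lobell_face n -> 'cV[R]_4) :
  (5 <= n)%N -> is_lobell_polyhedron e ->
  forall g, reflection_group e g -> \tr g \in Qfield [set cos (turn n)].
Proof.
move=> n5 Le g gG; have [k [c [_ [cE _] trK _ _]]] := lobell_invariants n5 Le.
apply: trK => //; rewrite cE -[k]muln1 cosnM mul1r chebyshev_closed //.
exact: Qfield_gen.
Qed.

Lemma trAd_reflection2 (a b : 'cV[R]_4) : lform a a = 1 -> lform b b = 1 ->
  trAd (reflection a *m reflection b) = 8 * lform a b ^+ 2 - 2.
Proof.
move=> aa bb; have [tr1 tr2 _] := reflection2_recurrence aa bb (erefl _).
have gI : IsomH3 (reflection a *m reflection b).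
  by apply: IsomH3_mul; apply: reflection_IsomH3.
by rewrite (trAdE gI) tr1 tr2; field.
Qed.

Lemma lobell_adjoint_trace_field n (e : lobell_face n -> 'cV[R]_4) :
  (5 <= n)%N -> is_lobell_polyhedron e ->
  adjoint_trace_field (reflection_group e) = Qadjoin [set cos (turn n)].
Proof.
move=> n5 Le; have unit := lobell_unit Le.
apply/seteqP; split=> x.
  move=> /(Qadjoin_sub (K := Qfield [set cos (turn n)])) xK; apply/QfieldP/xK.
  move=> _ /set_mem[g gG <-]; rewrite (trAdE (reflection_group_IsomH3 unit gG)).
  have trK := lobell_trace_field n5 Le.
  rewrite rpredM ?rpredV ?rpred_nat // rpredB ?rpredX ?trK //.
  exact: reflection_group_mul.
move=> /(Qadjoin_sub (K := Qfield [set trAd g | g in reflection_group e])) xK.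
apply/QfieldP/xK => _ /set_mem ->; set K := Qfield _.
have [k [c [kn [cE c01] _ tvE _]]] := lobell_invariants n5 Le.
apply: (cos_coprime_closed _ kn); first by lia.
rewrite -cE.
have : trAd (reflection (e (Top n)) *m reflection (e (Lower 0))) \in K.
  apply: Qfield_gen; eexists; last reflexivity.
  by apply: reflection_group_mul; apply: reflection_group_gen.
rewrite trAd_reflection2 // tvE => yK.
have -> : c = 4 / ((8 * (1 + (2 * c)^-1) - 2) - 6).
  by field; case/andP: c01 => c0 _; rewrite gt_eqF //; lra.
by rewrite rpredM ?rpredV ?rpred_nat // rpredB ?rpred_nat.
Qed.

Lemma lobell_power_trace n (e : lobell_face n -> 'cV[R]_4) :
  (5 <= n)%N -> is_lobell_polyhedron e ->
  exists k g, [/\ coprime k n, 0 < cos (k%:R * turn n), reflection_group e g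
    & forall m, \tr (g ^+ m) = qeval (power_trace m) (cos (k%:R * turn n))].
Proof.
move=> n5 Le; have unit := lobell_unit Le.
have [k [c [kn [cE /andP[c0 _]] _ _ uuE]]] := lobell_invariants n5 Le.
exists k, (reflection (e (Upper 0)) *m reflection (e (Upper (0 + 1 + 1)))).
rewrite -cE; split=> //.
  by apply: reflection_group_mul; apply: reflection_group_gen.
have [] := reflection2_recurrence (unit (Upper 0)) (unit (Upper (0 + 1 + 1))) (erefl _).
rewrite uuE; set g := _ *m _; set x := 2 * _ - 1 => tr1 _ trSS m.
rewrite power_traceE -/x.
elim/nat_ind2: m => [||m IH1 IH2].
- by rewrite expr0 mxtrace1 qeval1; ring.
- by rewrite expr1 tr1 qevalX; ring.
- rewrite qeval_chebyshevSS.
  have := trSS m; rewrite IH1 IH2 => E.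
  have -> : \tr (g ^+ m.+2) = 4 - 4 * x
      + 2 * x * (2 + 2 * qeval (chebyshev m.+1) x) - (2 + 2 * qeval (chebyshev m) x).
    by rewrite -E; ring.
  by ring.
Qed.

(** The trace of any positive power of the element of lobell_power_trace has
    degree at least (p - 1) / 2, whereas the traces of the second group have degree
    at most (q - 1) / 2. *)
Lemma lobell_degree_le p q (e : lobell_face p -> 'cV[R]_4)
    (f : lobell_face q -> 'cV[R]_4) :
    (5 <= p)%N -> (5 <= q)%N -> prime p -> prime q ->
    is_lobell_polyhedron e -> is_lobell_polyhedron f ->
    (forall g, reflection_group e g -> exists2 m, (0 < m)%N &
      exists2 h, reflection_group f h & \tr (g ^+ m) = \tr h) ->
  (p.-1./2 <= q.-1./2)%N.
Proof.
move=> p5 q5 pp qq Le Lf common.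
have [k [g [kp c0 gG trg]]] := lobell_power_trace p5 Le.
have [m m0 [h hG trE]] := common g gG.
have := lobell_trace_field q5 Lf hG; rewrite -trE trg => /QfieldP.
have alg := cos_turn_algebraic R qq (ltac:(lia) : (2 < q)%N).
have closed := algebraic_values_closed alg.
move=> /(_ _ (conj _ _))-/(_ [set qeval P (cos (turn q)) | P in [set: {poly rat}]]).
have closed' : divring_closed
    (mem [set qeval P (cos (turn q)) | P in [set: {poly rat}]]).
  by case: closed => c1 cB cV; split.
move=> /(_ closed').
have gen : [set cos (turn q)] `<=`
    [set qeval P (cos (turn q)) | P in [set: {poly rat}]].
  by move=> _ ->; exists 'X; rewrite // qevalX.
move=> /(_ gen)[P _ PE].
have [y [y0 ysize yroot]] := algebraic_value P alg.
have pNk : ~~ (p %| k)%N by rewrite -prime_coprime // coprime_sym.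
have := power_trace_degree pp (ltac:(lia) : (2 < p)%N) pNk c0 m0 y0.
rewrite -PE yroot => /(_ erefl) lt1.
by rewrite -ltnS (leq_trans lt1).
Qed.

Lemma lobell_incommensurable p q (e : lobell_face p -> 'cV[R]_4)
    (f : lobell_face q -> 'cV[R]_4) :
    (5 <= p)%N -> (5 <= q)%N -> prime p -> prime q -> p <> q ->
    is_lobell_polyhedron e -> is_lobell_polyhedron f ->
  ~ commensurable (reflection_group e) (reflection_group f).
Proof.
move=> p5 q5 pp qq pq Le Lf [g gI [finE finF]].
have gU := IsomH3_unit gI; set Gf := conj_group g _ in finE finF.
have eU := reflection_group_IsomH3 (lobell_unit Le).
have fU := reflection_group_IsomH3 (lobell_unit Lf).
have Xmem n (a : lobell_face n -> 'cV[R]_4) h m :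
    reflection_group a h -> reflection_group a (h ^+ m).
  move=> hG; elim: m => [|m IHm]; first exact: reflection_group1.
  by rewrite exprS; apply: reflection_group_mul.
have conjX (h : 'M[R]_4) m : (g *m h *m invmx g) ^+ m = g *m h ^+ m *m invmx g.
  elim: m => [|m IHm]; first by rewrite !expr0 mulmx1 mulmxV.
  by rewrite !exprS IHm -!mulmxE !mulmxA mulmxKV.
have tr_conj (h : 'M[R]_4) : \tr (g *m h *m invmx g) = \tr h.
  by rewrite -mulmxA mxtrace_mulC mulmxKV.
have H1 : (reflection_group e `&` Gf) 1%:M.
  split; first exact: reflection_group1.
  by exists 1%:M; [exact: reflection_group1|rewrite mulmx1 mulmxV].
(* A power of any element of either group is conjugate into the other one. *)
have pq_le : (p.-1./2 <= q.-1./2)%N.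
  apply: (lobell_degree_le p5 q5 pp qq Le Lf) => h hG.
  have [m m0 [_ [h' h'G hE]]] := finite_index_power finE H1
    (IsomH3_unit (eU _ hG)) (fun m => Xmem _ _ _ m hG).
  by exists m => //; exists h' => //; rewrite -hE tr_conj.
have qp_le : (q.-1./2 <= p.-1./2)%N.
  apply: (lobell_degree_le q5 p5 qq pp Lf Le) => h hG.
  have hU : g *m h *m invmx g \in unitmx.
    by rewrite !unitmx_mul unitmx_inv gU (IsomH3_unit (fU _ hG)).
  have hX m : Gf ((g *m h *m invmx g) ^+ m).
    by rewrite conjX; exists (h ^+ m) => //; apply: Xmem.
  have [m m0 [hE _]] := finite_index_power finF H1 hU hX.
  by exists m => //; exists ((g *m h *m invmx g) ^+ m); rewrite ?conjX ?tr_conj -?conjX.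
have odd_half n : prime n -> (5 <= n)%N -> n = (n.-1./2).*2.+1.
  move=> pn n5; have [n2|] := even_prime pn; first by rewrite n2 in n5.
  by case: (n) n5 => // n' _ /= on; rewrite -[in LHS](odd_double_half n') (negbTE on).
apply: pq; rewrite (odd_half p) // (odd_half q) //.
by congr (_.*2.+1); apply/eqP; rewrite eqn_leq pq_le.
Qed.

End Traces.

Theorem theorem1p4 (R : realType) :
  (forall (n : nat) (e : lobell_face n -> 'cV[R]_4),
     (5 <= n)%N -> is_lobell_polyhedron e ->
     adjoint_trace_field (reflection_group e)
       = Qadjoin [set cos (2%:R * pi / n%:R)]) /\
  (forall (p q : nat) (e : lobell_face p -> 'cV[R]_4)
          (f : lobell_face q -> 'cV[R]_4),
     (5 <= p)%N -> (5 <= q)%N -> prime p -> prime q -> p <> q ->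
     is_lobell_polyhedron e -> is_lobell_polyhedron f ->
     ~ commensurable (reflection_group e) (reflection_group f)).
Proof.
by split=> *; [exact: lobell_adjoint_trace_field|exact: lobell_incommensurable].
Qed.
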